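(* Let $q\ge4$. Then the vanishing set in $\mathbb{C}^q$ of the ideal $E_\Delta\subseteq\mathbb{C}[v_1,\dots,v_q]$ contains a nonzero point; equivalently, there is a nonzero $q\mathbb{Z}$-periodic potential on $\mathbb{Z}$ that is Floquet isospectral to $\mathbf{0}$.
   Context: On $\mathbb{Z}$, let $\Delta$ be the discrete Laplacian $(\Delta u)(n)=u(n-1)+u(n+1)$, and let $V$ be a $q\mathbb{Z}$-periodic potential with values $V(1)=v_1,\dots,V(q)=v_q$ treated as indeterminates. For $z$ a variable, $L_V(z)$ is the $q\times q$ matrix of $\Delta+V$ on functions with $u(n+q)=zu(n)$ (identified with their values at $1,\dots,q$), and $D_V(z,\lambda)=\det(L_V(z)-\lambda I)\in\mathbb{C}[v][z^{\pm1},\lambda]$. $E_\Delta$ is the ideal generated by all coefficients $[z^a\lambda^b](D_V(z,\lambda)-D_{\mathbf{0}}(z,\lambda))$, where $D_{\mathbf{0}}$ is obtained by setting all $v_i=0$. Two $q\mathbb{Z}$-periodic potentials are Floquet isospectral iff $D_V=D_{V'}$. *)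

(* Defs.v *)
From mathcomp Require Import all_boot all_algebra.
From mathcomp Require Import complex.
From mathcomp Require Import Rstruct.
Set Implicit Arguments. Unset Strict Implicit. Unset Printing Implicit Defensive.
Import GRing.Theory Num.Theory.
Local Open Scope ring_scope.

Definition C : numClosedFieldType := (Rdefinitions.R)[i].

(* L_V(z): the q x q matrix of (Delta + V) acting on functions u : Z -> C with
   u(n+q) = z u(n), identified with (u(1),...,u(q)) (0-based indices here:
   index i stands for site i+1).
   (L u)(i) = u(i-1) + u(i+1) + v_i u(i), with u(0) = z^-1 u(q) and
   u(q+1) = z u(1). *)
Definition floquet_mx (q : nat) (v : 'I_q -> C) (z : C) : 'M[C]_q :=
  \matrix_(i < q, j < q)
     ((if i == j then v i else 0)
      + (if (i.+1 < q)%N then (if (j : nat) == i.+1 then 1 else 0)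
         else (if (j : nat) == 0%N then z else 0))
      + (if (0 < i)%N then (if (j : nat) == i.-1 then 1 else 0)
         else (if (j : nat) == q.-1 then z^-1 else 0))).

Definition floquet_det (q : nat) (v : 'I_q -> C) (z lam : C) : C :=
  \det (floquet_mx v z - lam%:M).

(* V and V' are Floquet isospectral iff D_V = D_V' as Laurent polynomials in
   z and polynomials in lambda; over the infinite field C this is equality
   as functions on C^* x C. *)
Definition floquet_isospectral (q : nat) (v v' : 'I_q -> C) : Prop :=
  forall z lam : C, z != 0 -> floquet_det v z lam = floquet_det v' z lam.

(* Main.v *)
(** The characteristic polynomial of [Delta + V] is, up to a term depending only
    on the multiplier, a polynomial in [lambda] whose coefficients are
    polynomials in the [v_i].  For a potential that is odd under the reflection
    exchanging the sites [i] and [q - 1 - i], with [m = q / 2] free values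
    [x_0, ..., x_(m-1)], parity leaves [m] of these coefficients, and the [k]-th
    one has top part [(-1)^k e_k(x^2)], of degree [2 k].  Let [I] be the ideal of
    these [m] polynomials.  A triangular change of generators gives them leading
    monomials [x_i^(2(i+1))], so the quotient by [I] has dimension [2^m m!] and
    no monomial [x_(m-1)^j] with [j < 2 m] lies in [I].  On the other hand, at the
    origin the generators have no linear part, and degenerate second-order
    perturbation theory shows that the squares of the [m] nonconstant Fourier
    modes of [V] lie in [I] modulo cubic terms.  If the origin were the only
    zero, the [x_i] would be nilpotent modulo [I], hence every monomial of degree
    [m + 1] would be in [I]; for [m >= 2] this contradicts
    [x_(m-1)^(m+1) \notin I]. *)

Require Import Defs.
From Stdlib Require Import Classical IndefiniteDescription.
From mathcomp Require Import all_boot all_order all_algebra.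
From mathcomp Require Import fingroup perm cyclic separable cyclotomic complex.
From mathcomp Require Import mpoly.
From mathcomp Require Import ring zify.
Set Implicit Arguments. Unset Strict Implicit. Unset Printing Implicit Defensive.
Import Order.TTheory GRing.Theory Num.Theory.
Local Open Scope ring_scope.

(** * Ideals with triangular leading monomials *)

Section TriangularIdeal.
Variables (K : fieldType) (n : nat) (d : 'I_n -> nat).
Variable F : 'I_n -> {mpoly K[n]}.
Hypothesis d_gt0 : forall i, (0 < d i)%N.
Hypothesis mlead_F : forall i, mlead (F i) = (U_(i) *+ d i)%MM.

Implicit Types (f g p : {mpoly K[n]}) (m : 'X_{1..n}).

Let F_neq0 i : F i != 0.
Proof.
apply/eqP=> F0; have := mlead_F i; rewrite F0 mlead0 => /(congr1 (@mdeg n)).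
by rewrite mdeg0 mdegMn mdeg1 mul1n => e; have := d_gt0 i; rewrite -e.
Qed.

Definition in_ideal f := exists h : 'I_n -> {mpoly K[n]}, f = \sum_i h i * F i.

Lemma in_ideal0 : in_ideal 0.
Proof. by exists (fun=> 0); rewrite big1 // => i _; rewrite mul0r. Qed.

Lemma in_idealD f g : in_ideal f -> in_ideal g -> in_ideal (f + g).
Proof.
move=> [h ->] [k ->]; exists (fun i => h i + k i).
by rewrite -big_split; apply: eq_bigr => i _; rewrite mulrDl.
Qed.

Lemma in_idealM f g : in_ideal g -> in_ideal (f * g).
Proof.
move=> [h ->]; exists (fun i => f * h i).
by rewrite mulr_sumr; apply: eq_bigr => i _; rewrite mulrA.
Qed.

Lemma in_ideal_gen i : in_ideal (F i).
Proof.
exists (fun j => (j == i)%:R); rewrite (bigD1 i) //= eqxx mul1r big1 ?addr0 //.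
by move=> j /negbTE ->; rewrite mul0r.
Qed.

Lemma in_ideal_sum (T : Type) (s : seq T) (P : pred T) (G : T -> {mpoly K[n]}) :
  (forall t, P t -> in_ideal (G t)) -> in_ideal (\sum_(t <- s | P t) G t).
Proof. by move=> IG; apply: big_ind => //; [apply: in_ideal0 | apply: in_idealD]. Qed.

(* A basis element with leading monomial [m]: the [d]-adic digit of each
   exponent is taken by the variable, the quotient by the generator. *)
Definition adic m := \prod_i ('X_i ^+ (m i %% d i) * F i ^+ (m i %/ d i)).

Let factor_neq0 i a b : 'X_i ^+ a * F i ^+ b != 0 :> {mpoly K[n]}.
Proof. by rewrite mulf_neq0 ?expf_neq0 // -msupp_eq0 msuppX. Qed.

Lemma adic_neq0 m : adic m != 0.
Proof. by apply/prodf_neq0 => i _. Qed.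

Lemma mlead_adic m : mlead (adic m) = m.
Proof.
rewrite mlead_prod //.
rewrite [RHS]multinomUE_id; apply: eq_bigr => i _.
rewrite mleadM ?expf_neq0 // -?msupp_eq0 ?msuppX //.
rewrite !mleadX ?mleadXm ?mlead_F //; last by rewrite -msupp_eq0 msuppX.
apply/mnmP => j; rewrite mnmDE !mulmnE -mulnA -mulnDr mulnC.
by rewrite (mulnC (d i)) addnC -divn_eq mulnC.
Qed.

Lemma adic_reduced m : (forall i, m i < d i)%N -> adic m = 'X_[m].
Proof.
move=> red; rewrite mpolyXE_id; apply: eq_bigr => i _.
by rewrite modn_small ?divn_small ?red // expr0 mulr1.
Qed.

Lemma adicD m i : adic (m + U_(i) *+ d i) = adic m * F i.
Proof.
rewrite /adic [LHS](bigD1 i) // [in RHS](bigD1 i) //= -!mulrA; congr (_ * _).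
  by rewrite mnmDE mulmnE mnm1E eqxx mul1n modnDr.
rewrite mnmDE mulmnE mnm1E eqxx mul1n divnDr ?dvdnn // divnn d_gt0 addn1 exprSr.
rewrite -mulrA; congr (_ * _); rewrite mulrC; congr (_ * _).
apply: eq_bigr => j /negbTE ji.
by rewrite mnmDE mulmnE mnm1E eq_sym ji mul0n addn0.
Qed.

(** The linear endomorphism sending each monomial ['X_[m]] to [adic m]. It turns out to be bijective
    and to preserve leading monomials, and it carries the monomial ideal of the ['X_i ^+ d i] to the
    ideal of the [F i]. *)
Definition adic_comb g := \sum_(m <- msupp g) g@_m *: adic m.

Lemma adic_combE (s : seq 'X_{1..n}) g : uniq s -> {subset msupp g <= s} ->
  adic_comb g = \sum_(m <- s) g@_m *: adic m.
Proof.
move=> us sub; rewrite /adic_comb [RHS](bigID (mem (msupp g))) /=.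
rewrite [X in _ = _ + X]big1 ?addr0 => [|m /memN_msupp_eq0 ->]; last by rewrite scale0r.
rewrite -[RHS]big_filter; apply: perm_big; apply: uniq_perm => [||m].
- exact: msupp_uniq.
- exact: filter_uniq.
- by rewrite mem_filter; apply/idP/andP => [mg|[] //]; split=> //; apply: sub.
Qed.

Lemma adic_combD g1 g2 : adic_comb (g1 + g2) = adic_comb g1 + adic_comb g2.
Proof.
set s := undup (msupp g1 ++ msupp g2); have us : uniq s by apply: undup_uniq.
rewrite !(@adic_combE s) //; first last.
- by move=> m; rewrite mem_undup; apply: msuppD_le.
- by move=> m; rewrite mem_undup mem_cat => ->.
- by move=> m; rewrite mem_undup mem_cat => ->; rewrite orbT.
by rewrite -big_split; apply: eq_bigr => m _; rewrite mcoeffD scalerDl.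
Qed.

Lemma adic_comb0 : adic_comb 0 = 0.
Proof. by rewrite /adic_comb msupp0 big_nil. Qed.

Lemma adic_combZX c m : adic_comb (c *: 'X_[m]) = c *: adic m.
Proof.
rewrite (@adic_combE [:: m]) // => [|m' /msuppZ_le]; last by rewrite msuppX.
by rewrite big_seq1 mcoeffZ mcoeffX eqxx mulr1.
Qed.

Lemma adic_combMX g i : adic_comb (g * 'X_[U_(i) *+ d i]) = adic_comb g * F i.
Proof.
elim/mpolyind: g => [|c m g _ _ IH]; first by rewrite !mul0r adic_comb0 mul0r.
rewrite mulrDl !adic_combD mulrDl IH; congr (_ + _).
by rewrite -scalerAl -mpolyXD !adic_combZX adicD scalerAl.
Qed.

(** Triangularity: [adic m] has leading monomial [m], so no other term of the sum can cancel the one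
    at [mlead g]. *)
Lemma adic_comb_lead g : g != 0 -> adic_comb g != 0 /\ mlead (adic_comb g) = mlead g.
Proof.
move=> g0; have lg := mlead_supp g0.
rewrite /adic_comb (bigD1_seq (mlead g)) ?msupp_uniq //=.
set p := _ *: _; set q := \sum_(i <- _ | _) _.
have c0 : g@_(mlead g) != 0 by rewrite mleadc_eq0.
have lp : mlead p = mlead g by rewrite mleadZ // mlead_adic.
have qs m : m \in msupp q -> (m < mlead g)%O.
  move=> /msupp_sum_le /flattenP [_ /mapP [m' + ->]].
  rewrite mem_filter => /andP [nm' m'g] /msuppZ_le /msupp_le_mlead.
  rewrite mlead_adic => /le_lt_trans; apply.
  by rewrite lt_neqAle nm' msupp_le_mlead.
have pq : (p + q)@_(mlead g) != 0.
  rewrite mcoeffD (@memN_msupp_eq0 _ _ q); last first.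
    by apply/negP => /qs; rewrite ltxx.
  by rewrite addr0 -lp mleadc_eq0 scaler_eq0 negb_or c0 adic_neq0.
split; first by apply: contraNneq pq => ->; rewrite mcoeff0.
apply/le_anti/andP; split; last by rewrite msupp_le_mlead ?mcoeff_msupp.
have pq0 : p + q != 0 by apply: contraNneq pq => ->; rewrite mcoeff0.
have /msuppD_le := mlead_supp pq0; rewrite mem_cat => /orP [/msupp_le_mlead|/qs/ltW //].
by rewrite lp.
Qed.

(** Division algorithm: subtracting the right multiple of [adic (mlead f)] lowers the leading
    monomial, and the monomial order is well-founded. *)
Lemma adic_comb_surj f : exists g, f = adic_comb g.
Proof.
elim/mleadrect: f => f IH; have [->|f0] := eqVneq f 0.
  by exists 0; rewrite adic_comb0.
set m := mlead f; set b := adic m.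
have b0 : b@_m != 0 by rewrite -[X in _@_X](mlead_adic m) mleadc_eq0 adic_neq0.
set c := f@_m / b@_m; set f' := f - c *: b.
suff [g f'g] : exists g, f' = adic_comb g.
  by exists (g + c *: 'X_[m]); rewrite adic_combD adic_combZX -f'g subrK.
have [->|f'0] := eqVneq f' 0; first by exists 0; rewrite adic_comb0.
apply: IH; have ls := mlead_supp f'0; rewrite lt_neqAle; apply/andP; split.
  apply: contraTneq ls => ->; rewrite mcoeff_msupp negbK mcoeffB mcoeffZ.
  by rewrite divfK // subrr.
move/msuppB_le: ls; rewrite mem_cat => /orP [/msupp_le_mlead //|/msuppZ_le].
by move/msupp_le_mlead; rewrite mlead_adic.
Qed.

(** Pulled back along [adic_comb], an element of the ideal becomes a combination of the
    ['X_i ^+ d i]. Each of its monomials, in particular the preserved leading one, is divisible by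
    some of these powers. *)
Lemma mlead_in_ideal f : in_ideal f -> f != 0 -> exists i, (d i <= mlead f i)%N.
Proof.
move=> [h fE]; have [k hk] := functional_choice _ (fun i => adic_comb_surj (h i)).
set G := \sum_i k i * 'X_[U_(i) *+ d i].
have fG : f = adic_comb G.
  rewrite fE /G; apply: (big_ind2 (fun x y => x = adic_comb y)).
  - by rewrite adic_comb0.
  - by move=> x1 y1 x2 y2 -> ->; rewrite adic_combD.
  - by move=> i _; rewrite hk adic_combMX.
move=> f0; have G0 : G != 0 by apply: contraNneq f0 => G0; rewrite fG G0 adic_comb0.
have [_ lG] := adic_comb_lead G0; rewrite fG lG.
have /msupp_sum_le /flattenP [_ /mapP [i _ ->]] := mlead_supp G0.
rewrite (perm_mem (msuppMX _ _)) => /mapP [m _ ->]; exists i.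
by rewrite mnmDE mulmnE mnm1E eqxx mul1n leq_addr.
Qed.

Lemma adic_in_ideal m i : (d i <= m i)%N -> in_ideal (adic m).
Proof.
move=> dm; have le : (U_(i) *+ d i <= m)%MM.
  apply/mnm_lepP => j; rewrite mulmnE mnm1E.
  by case: eqP => [<-|_]; rewrite ?mul1n ?mul0n.
by rewrite -(submK le) adicD; apply: in_idealM (in_ideal_gen i).
Qed.

Definition reduced m := [forall i, m i < d i]%N.

(** On reduced exponents [adic m] is the monomial itself; every other [adic m] contains a factor
    [F i]. *)
Lemma in_ideal_reduce f :
  exists r, in_ideal (f - r) /\ {in msupp r, forall m, reduced m}.
Proof.
have [g ->] := adic_comb_surj f.
exists (\sum_(m <- msupp g | reduced m) g@_m *: 'X_[m]); split.
  rewrite /adic_comb (bigID reduced) /=.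
  under eq_bigr => m /forallP red do rewrite adic_reduced //.
  rewrite addrAC subrr add0r; apply: in_ideal_sum => m.
  rewrite negb_forall => /existsP [i di]; move: di; rewrite -leqNgt => dm.
  by rewrite -mul_mpolyC; apply/in_idealM/(adic_in_ideal dm).
move=> m /msupp_sum_le /flattenP [_ /mapP [m' + ->]].
by rewrite mem_filter => /andP [red _] /msuppZ_le; rewrite msuppX inE => /eqP ->.
Qed.

(** The finitely many reduced monomials span the quotient, so the powers of [f] are linearly
    dependent modulo the ideal. *)
Lemma in_ideal_algebraic f :
  exists2 p : {poly K}, p != 0 & in_ideal (map_poly (@mpolyC n K) p).[f].
Proof.
have [r rP] := functional_choice _ (fun j => in_ideal_reduce (f ^+ j)).
(* Reduced monomials have degree at most [\sum_i d i], so [T] contains them all; [#|T|.+1] powers of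
   [f] then force a dependency [u]. *)
pose D := (\sum_i d i).+1; pose T : finType := 'X_{1..n < D}.
pose A := \matrix_(j < #|T|.+1, t < #|T|) (r j)@_(enum_val t : T).
have [u uA u0] : exists2 u : 'rV_(#|T|.+1), u *m A = 0 & u != 0.
  have : kermx A != 0.
    by rewrite kermx_eq0 /row_free neq_ltn ltnS rank_leq_col.
  by case/rowV0Pn => u /sub_kermxP uA u0; exists u.
exists (\poly_(j < #|T|.+1) u 0 (inord j)).
  apply: contraNneq u0 => u0; apply/eqP/rowP => j; rewrite mxE.
  have := congr1 (fun p : {poly K} => p`_j) u0.
  by rewrite coef_poly ltn_ord inord_val coef0.
have -> : (map_poly (@mpolyC n K) (\poly_(j < #|T|.+1) u 0 (inord j))).[f]
    = \sum_(j < #|T|.+1) u 0 j *: f ^+ j.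
  rewrite poly_def rmorph_sum horner_sum; apply: eq_bigr => j _.
  by rewrite /= map_polyZ map_polyXn hornerZ hornerXn inord_val mul_mpolyC.
have r0 : \sum_(j < #|T|.+1) u 0 j *: r j = 0.
  apply/mpolyP => m; rewrite mcoeff0 raddf_sum /=.
  have [mD|mD] := ltnP (mdeg m) D.
    have := congr1 (fun B : 'rV_ _ => B 0 (enum_rank (BMultinom mD))) uA.
    rewrite [RHS]mxE [LHS]mxE => AE; rewrite -[RHS]AE; apply: eq_bigr => j _.
    by rewrite mcoeffZ [A _ _]mxE enum_rankK.
  rewrite big1 // => j _; rewrite mcoeffZ memN_msupp_eq0 ?mulr0 //.
  apply: contraL mD => /(proj2 (rP j)) /forallP red.
  by rewrite -ltnNge ltnS mdegE; apply: leq_sum => i _; apply: ltnW.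
have -> : \sum_(j < #|T|.+1) u 0 j *: f ^+ j = \sum_(j < #|T|.+1) u 0 j *: (f ^+ j - r j).
  under [RHS]eq_bigr => j _ do rewrite scalerBr.
  by rewrite big_split /= sumrN r0 subr0.
apply: in_ideal_sum => j _.
rewrite -mul_mpolyC; apply: in_idealM; exact: (proj1 (rP j)).
Qed.

End TriangularIdeal.

(** * Zeros and local structure of polynomial ideals *)

Definition is_ideal (R : comNzRingType) (I : R -> Prop) :=
  [/\ I 0, forall f g, I f -> I g -> I (f + g) & forall f g, I g -> I (f * g)].

Definition adjoin (R : comNzRingType) (I : R -> Prop) (a f : R) :=
  exists g b, I g /\ f = g + b * a.

Lemma adjoin_ideal (R : comNzRingType) (I : R -> Prop) a :
  is_ideal I -> is_ideal (adjoin I a).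
Proof.
move=> [I0 ID IM]; split=> [|f g [f1 [b [If1 ->]]] [g1 [c [Ig1 ->]]]|f g].
- by exists 0, 0; rewrite mul0r addr0.
- by exists (f1 + g1), (b + c); split; [apply: ID | ring].
- by case=> [g1 [c [Ig1 ->]]]; exists (f * g1), (f * c); split; [apply: IM | ring].
Qed.

Lemma adjoin_sub (R : comNzRingType) (I : R -> Prop) a f : I f -> adjoin I a f.
Proof. by move=> If; exists f, 0; rewrite mul0r addr0. Qed.

Lemma adjoin_gen (R : comNzRingType) (I : R -> Prop) a :
  is_ideal I -> adjoin I a a.
Proof. by move=> [I0 _ _]; exists 0, 1; rewrite mul1r add0r. Qed.

(** If every [x - c t] were invertible modulo [I], cancelling the factors one by one would leave [h]
    in [I]. *)
Lemma adjoin_root_proper (R : comNzRingType) (I : R -> Prop) (T : eqType)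
    (c : T -> R) (x h : R) (s : seq T) :
    is_ideal I -> ~ I h -> I (h * \prod_(t <- s) (x - c t)) ->
  exists2 t, t \in s & ~ adjoin I (x - c t) 1.
Proof.
move=> [I0 ID IM] nIh; elim: s => [|t s IH]; first by rewrite big_nil mulr1.
rewrite big_cons => Ih.
have [[g [b [Ig e1]]]|] := classic (adjoin I (x - c t) 1); last first.
  by exists t; rewrite ?mem_head.
have [t' ts nI] : exists2 t, t \in s & ~ adjoin I (x - c t) 1.
  (* Multiply [1 = g + b * (x - c t)] by [y]: the first term is in [I] through [g], the second
     through the full product. *)
  apply: IH; set y := h * _; have -> : y = y * g + b * (x - c t) * y.
    by rewrite mulrC -mulrDl -e1 mul1r.
  apply: ID; first exact: IM.
  rewrite /y [X in I X](_ : _ = b * (h * ((x - c t) * \prod_(t <- s) (x - c t)))).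
    exact: IM.
  by ring.
by exists t' => //; rewrite inE ts orbT.
Qed.

Lemma ideal_sum (R : comNzRingType) (I : R -> Prop) (T : Type) (s : seq T)
    (P : pred T) (G : T -> R) : is_ideal I ->
  (forall t, P t -> I (G t)) -> I (\sum_(t <- s | P t) G t).
Proof. by move=> [I0 ID _] IG; apply: big_ind. Qed.

Lemma idealN (R : comNzRingType) (I : R -> Prop) f : is_ideal I -> I f -> I (- f).
Proof. by move=> [_ _ IM] If; rewrite -mulN1r; apply: IM. Qed.

Lemma idealZ (R : comNzRingType) n (I : {mpoly R[n]} -> Prop) c f :
  is_ideal I -> I f -> I (c *: f).
Proof. by move=> [_ _ IM] If; rewrite -mul_mpolyC; apply: IM. Qed.

(** Modulo [I] each variable equals the constant [v i], and congruence respects sums and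
    products. *)
Lemma ideal_eval (K : fieldType) n (I : {mpoly K[n]} -> Prop) (v : 'I_n -> K) :
    is_ideal I -> (forall i, I ('X_i - (v i)%:MP)) ->
  forall f, I (f - (f.@[v])%:MP).
Proof.
move=> idI Iv f; have [I0 ID IM] := idI.
have congM a a' b b' : I (a - a') -> I (b - b') -> I (a * b - a' * b').
  move=> Ia Ib; rewrite [X in I X](_ : _ = a * (b - b') + b' * (a - a')); last by ring.
  by apply: ID; apply: IM.
elim/mpolyind: f => [|c m f _ _ IH]; first by rewrite meval0 mpolyC0 subr0.
rewrite mevalD mevalZ mevalX mpolyCD mpolyCM opprD addrACA; apply: ID => //.
rewrite -mul_mpolyC; apply: (congM); first by rewrite subrr.
rewrite mpolyXE_id rmorph_prod /=.
apply: (big_ind2 (fun x y => I (x - y))) => [||i _]; first by rewrite subrr.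
  by move=> *; apply: (congM).
rewrite rmorphXn /=; elim: (m i) => [|k IHk]; first by rewrite subrr.
by rewrite !exprS; apply: (congM).
Qed.

(* Each adjunction of some [X_i - r], where [r] is a root of a polynomial
   annihilating [X_i], can be kept proper; after the last variable, the
   residue of a polynomial is its value at the chosen roots. *)
Lemma ideal_zero (K : closedFieldType) n (I : {mpoly K[n]} -> Prop) (i0 : 'I_n) :
    is_ideal I ->
    (forall i, exists2 p : {poly K}, p != 0 & I (map_poly (@mpolyC n K) p).['X_i]) ->
    (forall e, ~ I ('X_i0 ^+ e)) ->
  exists2 v : 'I_n -> K, v i0 != 0 & forall f, I f -> f.@[v] = 0.
Proof.
move=> idI algI nilI.
(* Over a closed field the annihilating polynomial splits; its leading coefficient is a unit and is
   divided out. *)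
have {}algI i : exists s : seq K, I (\prod_(z <- s) ('X_i - z%:MP)).
  have [p p0 Ip] := algI i; have [s ps] := closed_field_poly_normal p.
  exists s; have [_ _ IM] := idI.
  move: Ip; rewrite ps map_polyZ hornerZ rmorph_prod horner_prod /= => Ip.
  have := IM (lead_coef p)^-1%:MP _ Ip.
  rewrite mulrA -mpolyCM mulVf ?lead_coef_eq0 // mul1r.
  under eq_bigr => z _ do rewrite rmorphB /= map_polyX map_polyC hornerXsubC.
  by [].
(* The zero roots are collected into a power of ['X_i0], which is not in [I] and serves as [h]; a
   nonzero root is then available for [i0]. *)
have [z0 z00 nz0] : exists2 z, z != 0 & ~ adjoin I ('X_i0 - z%:MP) 1.
  have [s Is] := algI i0.
  have [|z] := @adjoin_root_proper _ I _ (@mpolyC n K) 'X_i0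
    ('X_i0 ^+ count (pred1 0) s) [seq z <- s | z != 0] idI (nilI _).
    rewrite big_filter; move: Is; rewrite (bigID (pred1 0)) /=.
    rewrite (eq_bigr (fun=> 'X_i0)) => [|z /eqP ->]; last by rewrite subr0.
    by rewrite big_const_seq iter_mulr_1.
  by rewrite mem_filter => /andP [z00 _]; exists z.
suff [v [J [idJ nJ IJ v0 vJ]]] : exists v J, [/\ is_ideal J, ~ J 1,
    forall f, I f -> J f, v i0 != 0 &
    forall i, i \in i0 :: enum 'I_n -> J ('X_i - (v i)%:MP)].
  (* A nonzero value of [f] at [v] would be a unit lying in the proper ideal [J]. *)
  exists v => // f /IJ Jf; apply/eqP; apply: contra_notT nJ => fv.
  have [_ ID IM] := idJ.
  have Jv : J (f.@[v])%:MP.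
    have vJ' i : J ('X_i - (v i)%:MP) by apply: vJ; rewrite inE mem_enum orbT.
    have := idealN idJ (ideal_eval idJ vJ' f); rewrite opprB => Jvf.
    by rewrite -(subrK f (f.@[v])%:MP); apply: ID.
  by have := IM (f.@[v])^-1%:MP _ Jv; rewrite -mpolyCM mulVf // mpolyC1.
elim: (enum 'I_n) => [|j s [v [J [idJ nJ IJ v0 vJ]]]].
  exists (fun=> z0), (adjoin I ('X_i0 - z0%:MP)); split=> //.
  - exact: adjoin_ideal.
  - by move=> f; apply: adjoin_sub.
  - by move=> i; rewrite inE => /eqP ->; apply: adjoin_gen.
(* A variable already treated is skipped, so the nonzero value at [i0] is never overwritten. *)
have [js|js] := boolP (j \in i0 :: s).
  exists v, J; split=> // i; rewrite !inE orbCA => /predU1P [->|]; first exact: vJ.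
  by move=> ?; apply: vJ; rewrite inE.
have [r Ir] := algI j.
have [|z _ nz] := @adjoin_root_proper _ J _ (@mpolyC n K) 'X_j 1 r idJ nJ.
  by rewrite mul1r; apply: IJ.
exists (fun i => if i == j then z else v i), (adjoin J ('X_j - z%:MP)); split=> //.
- exact: adjoin_ideal.
- by move=> f /IJ; apply: adjoin_sub.
- by case: (i0 =P j) => // ij; rewrite ij mem_head in js.
move=> i; rewrite !inE orbCA; case: (i =P j) => [-> _|_ /= iis].
  exact: adjoin_gen.
by apply/adjoin_sub/vJ; rewrite inE.
Qed.

(** * Order of vanishing at the origin *)

Section Order.
Variables (K : fieldType) (n : nat).
Implicit Types f g : {mpoly K[n]}.

(** Membership in the [d]-th power of the maximal ideal of the origin. *)
Definition ord_ge (d : nat) f := {in msupp f, forall m, (d <= mdeg m)%N}.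

Lemma ord_ge0 d : ord_ge d 0.
Proof. by move=> m; rewrite msupp0. Qed.

Lemma ord_geD d f g : ord_ge d f -> ord_ge d g -> ord_ge d (f + g).
Proof.
by move=> fd gd m /msuppD_le; rewrite mem_cat => /orP [/fd|/gd].
Qed.

Lemma ord_geZ d c f : ord_ge d f -> ord_ge d (c *: f).
Proof. by move=> fd m /msuppZ_le /fd. Qed.

Lemma ord_geM d e f g : ord_ge d f -> ord_ge e g -> ord_ge (d + e) (f * g).
Proof.
move=> fd ge m /msuppM_le /allpairsP [[m1 m2] /= [/fd d1 /ge e2 ->]].
by rewrite mdegD leq_add.
Qed.

Lemma ord_ge_sum d (T : Type) (s : seq T) (P : pred T) (G : T -> {mpoly K[n]}) :
  (forall t, P t -> ord_ge d (G t)) -> ord_ge d (\sum_(t <- s | P t) G t).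
Proof. by move=> GP; apply: big_ind => //; [apply: ord_ge0 | apply: ord_geD]. Qed.

Lemma ord_geX d (m : 'X_{1..n}) : (d <= mdeg m)%N -> ord_ge d 'X_[m].
Proof. by move=> dm m'; rewrite msuppX inE => /eqP ->. Qed.

Lemma ord_ge_prod (T : Type) (t : seq T) (s : T -> {mpoly K[n]}) :
  (forall k, ord_ge 1 (s k)) -> ord_ge (size t) (\prod_(k <- t) s k).
Proof.
move=> s1; elim: t => [|k t IH]; first by rewrite big_nil.
by rewrite big_cons /= -add1n; apply: ord_geM.
Qed.

End Order.

Lemma nuniq_perm (T : eqType) (u : seq T) :
  ~~ uniq u -> exists k u', perm_eq u (k :: k :: u').
Proof.
elim: u => //= x u IH; rewrite negb_and negbK; have [xu _|_ /= /IH] := boolP (x \in u).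
  by exists x, (rem x u); rewrite perm_cons perm_to_rem.
move=> [k [u' pu]]; exists k, (x :: u').
apply: (perm_trans (y := x :: k :: k :: u')); first by rewrite perm_cons.
exact: (permEl (perm_catCA [:: x] [:: k; k] u')).
Qed.

(* With [p] linear forms spanning all variables, a product of more than [p] of
   them contains a square, which can be traded modulo [I] for terms of higher
   order; the variables being nilpotent, this ends in [I]. *)
Lemma ideal_high_order (K : fieldType) n p (I : {mpoly K[n]} -> Prop)
    (s : 'I_p -> {mpoly K[n]}) (q : nat)
    (c : 'I_n -> 'I_q -> K) (k : 'I_q -> 'I_p) :
    is_ideal I ->
    (forall j, ord_ge 1 (s j)) ->
    (forall i, 'X_i = \sum_t c i t *: s (k t)) ->
    (forall j, exists2 b, ord_ge 3 b & I (s j ^+ 2 - b)) ->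
    (forall i, exists e, I ('X_i ^+ e)) ->
  forall f, ord_ge p.+1 f -> I f.
Proof.
move=> idI s1 Xs sq nil; have [I0 ID IM] := idI.
(* [J d f]: modulo [I], [f] can be pushed to order at least [d.+1]. *)
pose J d f := exists2 b, ord_ge d.+1 b & I (f - b).
have JD d f g : J d f -> J d g -> J d (f + g).
  move=> [b bd fb] [b' bd' gb']; exists (b + b'); first exact: ord_geD.
  by rewrite opprD addrACA; apply: ID.
have JZ d a f : J d f -> J d (a *: f).
  move=> [b bd fb]; exists (a *: b); first exact: ord_geZ.
  by rewrite -scalerBr; apply: idealZ.
have Jsum d (T : Type) (r : seq T) (G : T -> {mpoly K[n]}) :
    (forall t, J d (G t)) -> J d (\sum_(t <- r) G t).
  move=> JG; apply: big_ind => //; last by apply: JD.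
  by exists 0; [apply: ord_ge0 | rewrite subr0].
have Jprod u : (p < size u)%N -> J (size u) (\prod_(j <- u) s j).
  move=> pu; have [|j [u' pu']] := @nuniq_perm _ u.
    apply: contraL pu => /card_uniqP <-; rewrite -leqNgt.
    by rewrite -[X in (_ <= X)%N]card_ord max_card.
  rewrite (perm_big _ pu') (perm_size pu') !big_cons /= mulrA -expr2.
  have [b b3 Ib] := sq j; exists (b * \prod_(j <- u') s j).
    by rewrite -(add3n (size u')); apply: ord_geM => //; apply: ord_ge_prod.
  by rewrite -mulrBl mulrC; apply: IM.
(* The variables of the monomial are expanded one at a time into linear forms, which move to the
   list [u]; once none is left, [Jprod] applies. *)
have JX a : forall m u, mdeg m = a -> (p < size u + mdeg m)%N ->
    J (size u + mdeg m)%N ((\prod_(j <- u) s j) * 'X_[m]).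
  elim: a => [|a IH] m u ma.
    move/eqP: ma; rewrite mdeg_eq0 => /eqP ->; rewrite mdeg0 addn0 mpolyX0 mulr1.
    exact: Jprod.
  have [i mi] : exists i, m i != 0%N.
    apply/existsP; apply: contra_eqT ma => /existsPn m0.
    by rewrite mdegE big1 // => i _; apply/eqP; have := m0 i; rewrite negbK.
  have mE : (m - U_(i) + U_(i))%MM = m by rewrite submK // lep1mP.
  have da : mdeg (m - U_(i)) = a.
    by move: ma; rewrite -{1}mE mdegD mdeg1 addn1 => -[].
  move=> pu; have -> : \prod_(j <- u) s j * 'X_[m] =
      \sum_t c i t *: (\prod_(j <- k t :: u) s j * 'X_[m - U_(i)]).
    rewrite -{1}mE mpolyXD Xs !mulr_sumr; apply: eq_bigr => t _.
    by rewrite big_cons -!scalerAr; congr (_ *: _); ring.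
  apply: Jsum => t; apply: JZ; rewrite ma -da addnS -addSn.
  by apply: (IH _ (k t :: u)) => //; rewrite /= da addSn -addnS -ma.
have Jord d f : (p < d)%N -> ord_ge d f -> J d f.
  move=> pd fd; rewrite (mpolyE f) big_seq.
  apply: big_ind => //; first by exists 0; [apply: ord_ge0 | rewrite subr0].
    by apply: JD.
  move=> m /fd; rewrite leq_eqVlt => /predU1P [dm|dm]; apply: JZ.
    by have := JX _ m [::] erefl; rewrite big_nil mul1r add0n -dm; apply.
  by exists 'X_[m]; [apply: ord_geX | rewrite subrr].
have [e eP] := functional_choice _ nil.
(* At this order every monomial has some exponent [m i] at least [e i], hence lies in [I] by
   nilpotency. *)
move=> f fp; have [b bord Ifb] :
    exists2 b, ord_ge (p.+1 + \sum_i e i)%N b & I (f - b).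
  elim: (\sum_i e i)%N => [|a [b bord Ifb]].
    by exists f; rewrite ?addn0 // subrr.
  have [|b' bord' Ib'] := Jord _ b _ bord; first by rewrite addSn ltnS leq_addr.
  exists b'; first by rewrite addnS.
  by rewrite -(subrK b f) -addrA; apply: ID.
rewrite -(subrK b f); apply: ID => //; rewrite (mpolyE b) big_seq.
apply: ideal_sum => // m /bord mb; apply: idealZ => //.
have [i ei] : exists i, (e i <= m i)%N.
  apply/existsP; apply: contraLR mb => /existsPn me; rewrite -ltnNge mdegE.
  apply: (@leq_ltn_trans (\sum_i e i)); last by rewrite addSn ltnS leq_addl.
  by apply: leq_sum => i _; have := me i; rewrite -ltnNge => /ltnW.
have le : (U_(i) *+ e i <= m)%MM.
  apply/mnm_lepP => j; rewrite mulmnE mnm1E.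
  by case: eqP => [<-|_]; rewrite ?mul1n ?mul0n.
by rewrite -(submK le) mpolyXD -mpolyXn; apply: IM.
Qed.

(** * Periodic Jacobi matrices *)

Section FloquetMatrix.
Variables (R : comNzRingType) (n : nat).
Implicit Types (d : 'I_n.+1 -> R) (z w : R).

(** The matrix of [floquet_mx] over any commutative ring: the corners [z] and [w] are independent,
    so that no inverse is required, and [d] may absorb the spectral parameter. *)
Definition fmx d z w : 'M[R]_n.+1 :=
  \matrix_(i, j)
     ((if i == j then d i else 0)
      + (if (i.+1 < n.+1)%N then (if (j : nat) == i.+1 then 1 else 0)
         else (if (j : nat) == 0%N then z else 0))
      + (if (0 < i)%N then (if (j : nat) == i.-1 then 1 else 0)
         else (if (j : nat) == n then w else 0))).

Lemma eq_fmx d d' z w : d =1 d' -> fmx d z w = fmx d' z w.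
Proof. by move=> dd'; apply/matrixP => i j; rewrite !mxE dd'. Qed.

Lemma fmx_mulr d z w (u : nat -> R) (i : 'I_n.+1) :
  \sum_j fmx d z w i j * u j = d i * u i
    + (if (i < n)%N then u i.+1 else z * u 0%N)
    + (if (0 < i)%N then u i.-1 else w * u n).
Proof.
have pick (k : nat) (x : R) : (k <= n)%N ->
    \sum_(j < n.+1) (if (j : nat) == k then x else 0) * u j = x * u k.
  move=> kn; rewrite (bigD1 (inord k)) //= inordK ?ltnS // eqxx.
  rewrite big1 ?addr0 // => j jk; case: eqP => [e|]; last by rewrite mul0r.
  by case/eqP: jk; apply: val_inj; rewrite /= inordK ?ltnS.
under eq_bigr => j _ do rewrite mxE !mulrDl.
rewrite !big_split /=; congr (_ + _ + _).
- under eq_bigr => j _ do rewrite eq_sym -(inj_eq val_inj) /=.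
  by rewrite pick // -ltnS.
- rewrite ltnS; case: ifP => i_lt; last by rewrite pick.
  by rewrite pick // mul1r.
- case: ifP => i_gt; last by rewrite pick.
  by rewrite pick ?mul1r //; have := ltn_ord i; lia.
Qed.

Lemma fmx_offdiag d d' z w i j : i != j -> fmx d z w i j = fmx d' z w i j.
Proof. by move=> /negbTE ij; rewrite !mxE ij. Qed.

Lemma fmx_noncorner d z w (i j : 'I_n.+1) :
  ~~ ((i == ord_max) && (j == ord0)) -> ~~ ((i == ord0) && (j == ord_max)) ->
  fmx d z w i j = fmx d 1 1 i j.
Proof.
rewrite -!(inj_eq val_inj) /= => c1 c2; rewrite !mxE; congr (_ + _ + _).
  have := ltn_ord i; case: ifP => // i1; case: ifP => // j0; lia.
by case: ifP => // i1; case: ifP => // j0; lia.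
Qed.

(** The positions where [fmx] can be nonzero: the diagonal and the edges of the cycle. *)
Definition cyc_adj (i j : nat) :=
  [|| i == j, j == i.+1, i == j.+1, (i == n) && (j == 0%N) | (i == 0%N) && (j == n)].

Lemma cyc_adjP (i j : nat) : cyc_adj i j ->
  [\/ i = j, j = i.+1, i = j.+1 | i = n /\ j = 0%N \/ i = 0%N /\ j = n].
Proof.
case/or4P=> [/eqP|/eqP|/eqP|/orP]; [by constructor..|].
by case=> /andP [/eqP ? /eqP ?]; apply: Or44; [left|right].
Qed.

Lemma fmx_eq0 d z w (i j : 'I_n.+1) : ~~ cyc_adj i j -> fmx d z w i j = 0.
Proof.
rewrite /cyc_adj !negb_or => /and5P [ij ji1 ij1 c1 c2].
rewrite mxE -(inj_eq val_inj) /= (negbTE ij) add0r.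
rewrite (_ : (if _ then _ else _) = 0) ?add0r.
  by case: ifP => i0; case: ifP => // j0; lia.
by have := ltn_ord i; case: ifP => i0; case: ifP => // j0; lia.
Qed.

Definition dterm (s : 'S_n.+1) d z w := \prod_i fmx d z w i (s i).

(** The product either has a factor off the cyclic pattern, hence vanishes, or avoids the diagonal,
    the only place where [d] occurs. *)
Lemma dterm_noloop (s : 'S_n.+1) d d' z w :
  ((forall i : 'I_n.+1, cyc_adj i (s i)) -> forall i, s i != i) ->
  dterm s d z w = dterm s d' z w.
Proof.
move=> noloop; have [/forallP adj|] := boolP [forall i : 'I_n.+1, cyc_adj i (s i)].
  by apply: eq_bigr => i _; apply: fmx_offdiag; rewrite eq_sym noloop.
rewrite negb_forall => /existsP [i ni].
by rewrite /dterm [LHS](bigD1 i) // [RHS](bigD1 i) //= !fmx_eq0 // !mul0r.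
Qed.

Lemma dterm_wrap_up (s : 'S_n.+1) d d' z w : (0 < n)%N ->
  s ord_max = ord0 -> s ord0 != ord_max -> dterm s d z w = dterm s d' z w.
Proof.
move=> n0 smax s0; apply: dterm_noloop => adj.
have inj : injective s by apply: perm_inj.
(* The other neighbours of [k] are already images of smaller sites or of the last one, so
   injectivity forces [k |-> k.+1]: the permutation is the cyclic shift, without fixed points. *)
have up (k : nat) (kn : (k < n.+1)%N) : (k < n)%N -> s (Ordinal kn) = k.+1 :> nat.
  elim: k {-2}k (leqnn k) kn => [|b IH] k kb kn k_lt.
    move: kb kn k_lt; rewrite leqn0 => /eqP -> kn k_lt.
    have e0 : Ordinal kn = ord0 by apply: val_inj.
    rewrite e0; have /cyc_adjP := adj ord0.
    move=> /= [e|//|//|[[e _]|[_ e]]].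
    - have : s ord0 = s ord_max by rewrite smax; apply: val_inj; rewrite /= -e.
      by move/inj => /(congr1 val) /= e'; lia.
    - by lia.
    - by case/eqP: s0; apply: val_inj.
  case: k kb kn k_lt => [|k] kb kn k_lt; first exact: (IH 0%N).
  have kn' : (k < n.+1)%N by apply: ltnW.
  have sk := IH k kb kn' (ltnW k_lt).
  have /cyc_adjP := adj (Ordinal kn).
  move=> /= [e|//|e|[[e _]|[// e]]].
  - have : s (Ordinal kn) = s (Ordinal kn') by apply: val_inj; rewrite /= -e sk.
    by move/inj => /(congr1 val) /= e'; lia.
  - case: e => e; case: k kb kn k_lt kn' sk e => [|k] kb kn k_lt kn' sk e.
      have : s (Ordinal kn) = s ord_max by rewrite smax; apply: val_inj; rewrite /= -e.
      by move/inj => /(congr1 val) /= e'; lia.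
    have kn2 : (k < n.+1)%N by apply: ltnW.
    have sk2 : s (Ordinal kn2) = k.+1 :> nat by apply: IH; lia.
    have : s (Ordinal kn) = s (Ordinal kn2) by apply: val_inj; rewrite /= -e sk2.
    by move/inj => /(congr1 val) /= e'; lia.
  - by lia.
move=> i; apply/eqP => si; have [i_lt|i_ge] := ltnP i n.
  have := up i (ltn_ord i) i_lt; rewrite (_ : Ordinal _ = i) ?si; last exact: val_inj.
  lia.
have e : i = ord_max by apply: val_inj => /=; have := ltn_ord i; lia.
by move: si; rewrite e smax => /(congr1 val) /= e'; lia.
Qed.

Definition rev_perm : 'S_n.+1 := perm (@rev_ord_inj n.+1).

Lemma fmx_rev d z w i j :
  fmx (d \o @rev_ord n.+1) z w i j = fmx d w z (rev_ord i) (rev_ord j).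
Proof.
rewrite !mxE (inj_eq rev_ord_inj) /= -!addrA; congr (_ + _); rewrite addrC.
have := ltn_ord i; have := ltn_ord j => jn i_n.
have ifE (a a' b b' c c' : bool) (x : R) :
    c = c' -> (c -> a = a') -> (~~ c -> b = b') ->
    (if c then if a then 1 else 0 else if b then x else 0)
    = (if c' then if a' then 1 else 0 else if b' then x else 0).
  by move=> ->; case: c' => [-> //|_ ->].
by congr (_ + _); apply: ifE; lia.
Qed.

Lemma dterm_rev s d z w :
  dterm s (d \o @rev_ord n.+1) z w = dterm (rev_perm * s * rev_perm)%g d w z.
Proof.
rewrite /dterm (reindex_inj (@rev_ord_inj n.+1)) /=; apply: eq_bigr => i _.
by rewrite fmx_rev rev_ordK !permM !permE.
Qed.

(** Mirror image of [dterm_wrap_up]: reversing the sites exchanges the two corners. *)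
Lemma dterm_wrap_down (s : 'S_n.+1) d d' z w : (0 < n)%N ->
  s ord0 = ord_max -> s ord_max != ord0 -> dterm s d z w = dterm s d' z w.
Proof.
move=> n0 s0 smax.
have dE e : dterm s e z w = dterm s ((e \o @rev_ord n.+1) \o @rev_ord n.+1) z w.
  by apply: eq_bigr => i _; rewrite !mxE /= rev_ordK.
have r0 : rev_ord ord0 = ord_max :> 'I_n.+1 by apply: val_inj; rewrite /= subn1.
have r1 : rev_ord ord_max = ord0 :> 'I_n.+1 by rewrite -r0 rev_ordK.
have rE i : rev_perm i = rev_ord i by rewrite permE.
rewrite dE (dE d') [LHS]dterm_rev [RHS]dterm_rev; apply: dterm_wrap_up => //.
  by rewrite !permM !rE r1 s0 r1.
by rewrite !permM !rE r0 -[X in _ != X]r0 (inj_eq rev_ord_inj).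
Qed.

(* A permutation using exactly one of the two corners is a cyclic shift, whose
   term does not see the diagonal; if both corners occur, [z * w = 1]. *)
Lemma det_fmx_diff d d' z w : (2 <= n)%N -> z * w = 1 ->
  \det (fmx d z w) - \det (fmx d' z w) = \det (fmx d 1 1) - \det (fmx d' 1 1).
Proof.
move=> n2 zw; rewrite /determinant -!sumrB; apply: eq_bigr => s _.
rewrite -!mulrBr; congr (_ * _); rewrite -!/(dterm _ _ _ _).
have n0 : (0 < n)%N by apply: leq_trans n2.
have [smax|smax] := eqVneq (s ord_max) ord0; have [s0|s0] := eqVneq (s ord0) ord_max.
- have dE e : dterm s e z w = dterm s e 1 1.
    have ne : ord0 != ord_max :> 'I_n.+1.
      by rewrite -(inj_eq val_inj) /=; lia.
    have splitD (f : 'I_n.+1 -> R) :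
        \prod_i f i = f ord0 * f ord_max * \prod_(i | (i != ord0) && (i != ord_max)) f i.
      by rewrite (bigD1 ord0) // (bigD1 ord_max) 1?eq_sym //= mulrA.
    rewrite /dterm !splitD; congr (_ * _); last first.
      apply: eq_bigr => i /andP [/negbTE i0 /negbTE i1].
      by apply: fmx_noncorner; rewrite ?i0 ?i1.
    have ne' : (ord_max == ord0 :> 'I_n.+1) = false by rewrite eq_sym (negbTE ne).
    rewrite s0 smax !mxE (negbTE ne) ne' /= !eqxx !ltnn !ltnS n0.
    (* For [n >= 2] the corners are not also nearest-neighbour positions, so their entries are
       exactly [z] and [w]. *)
    have -> : (n == 1%N) = false by lia.
    have -> : (0 == n.-1)%N = false by lia.
    by rewrite !addr0 !add0r mulrC zw mulr1.
  by rewrite !dE.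
- by rewrite !(@dterm_wrap_up s d d') // !subrr.
- by rewrite !(@dterm_wrap_down s d d') // !subrr.
suff dE e : dterm s e z w = dterm s e 1 1 by rewrite !dE.
apply: eq_bigr => i _; apply: fmx_noncorner.
  by apply/negP => /andP [/eqP -> /eqP sm]; rewrite sm eqxx in smax.
by apply/negP => /andP [/eqP -> /eqP sm]; rewrite sm eqxx in s0.
Qed.

Lemma det_fmx_rev d z w :
  \det (fmx (d \o @rev_ord n.+1) z w) = \det (fmx d w z).
Proof.
have -> : fmx (d \o @rev_ord n.+1) z w = row_perm rev_perm (col_perm rev_perm (fmx d w z)).
  by apply/matrixP => i j; rewrite fmx_rev !(mxE row_perm_key) !(mxE col_perm_key) !permE.
rewrite row_permE col_permE !det_mulmx !det_perm odd_permV mulrCA.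
by rewrite -signr_addb addbb mulr1.
Qed.

(** Conjugation by the signs [(-1) ^+ i] negates the nearest-neighbour entries; a corner joins sites
    at distance [n], whence the extra sign [(-1) ^+ n.+1] on [z] and [w]. *)
Lemma det_fmxN d z w :
  \det (fmx (fun i => - d i) z w)
    = (-1) ^+ n.+1 * \det (fmx d ((-1) ^+ n.+1 * z) ((-1) ^+ n.+1 * w)).
Proof.
pose D : 'M[R]_n.+1 := diag_mx (\row_i (-1) ^+ i).
have DD : \det D * \det D = 1.
  rewrite det_diag -big_split /= big1 // => i _.
  by rewrite mxE -exprMn mulrNN mulr1 expr1n.
have -> : fmx (fun i => - d i) z w
    = (-1) *: (D *m fmx d ((-1) ^+ n.+1 * z) ((-1) ^+ n.+1 * w) *m D).
  apply/matrixP => i j; rewrite mxE mul_mx_diag mxE mul_diag_mx !mxE.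
  have sgE (a b c : nat) (x : R) : odd (a + b + c) ->
      x = -1 * ((-1) ^+ a * ((-1) ^+ b * x) * (-1) ^+ c).
    move=> o; transitivity (- (-1) ^+ (a + b + c) * x).
      by rewrite -signr_odd o opprK mul1r.
    by rewrite !exprD; ring.
  have sgE1 (a c : nat) (x : R) : odd (a + c) -> x = -1 * ((-1) ^+ a * x * (-1) ^+ c).
    by move=> o; rewrite [LHS](sgE a 0%N c) ?addn0 // expr0 mul1r.
  have := ltn_ord i; have := ltn_ord j => jn i_n.
  rewrite !(mulrDl, mulrDr); congr (_ + _ + _).
  - case: eqP => [->|_]; last by rewrite !(mulr0, mul0r).
    by rewrite mulrAC -exprD addnn -signr_odd odd_double mul1r mulN1r.
  - case: ifP => i1; case: ifP => [/eqP j1|]; rewrite ?(mulr0, mul0r) //.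
      by apply: sgE1; rewrite j1; lia.
    by apply: sgE; lia.
  - case: ifP => i1; case: ifP => [/eqP j1|]; rewrite ?(mulr0, mul0r) //.
      by apply: sgE1; rewrite j1; lia.
    by apply: sgE; lia.
by rewrite detZ !det_mulmx mulrAC DD mul1r.
Qed.

End FloquetMatrix.

Lemma map_fmx (R S : comNzRingType) (f : {rmorphism R -> S}) n (d : 'I_n.+1 -> R) z w :
  map_mx f (fmx d z w) = fmx (f \o d) (f z) (f w).
Proof.
apply/matrixP => i j; rewrite !mxE !rmorphD /=.
by do 3!(congr (_ + _) || idtac); repeat case: ifP => _; rewrite ?rmorph0 ?rmorph1.
Qed.

Lemma det_map_fmx (R S : comNzRingType) (f : {rmorphism R -> S}) n (d : 'I_n.+1 -> R) z w :
  f (\det (fmx d z w)) = \det (fmx (f \o d) (f z) (f w)).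
Proof. by rewrite -map_fmx det_map_mx. Qed.

(** * Fourier transform *)

Lemma sum_unity_root (K : fieldType) (q : nat) (x : K) :
  x ^+ q = 1 -> x != 1 -> \sum_(i < q) x ^+ i = 0.
Proof.
move=> xq x1; apply: (mulfI (x := x - 1)); first by rewrite subr_eq0.
by rewrite -subrX1 xq subrr mulr0.
Qed.

Section Fourier.
Variables (K : fieldType) (R : comNzRingType) (f : {rmorphism K -> R}) (n : nat).
Variables (omega zeta c : K) (v : 'I_n.+1 -> R).
Hypotheses (prim : n.+1.-primitive_root omega) (zeta0 : zeta != 0).

Let node (j : nat) := zeta * omega ^+ j.

Let omega0 j : omega ^+ j != 0.
Proof.
apply: expf_neq0; apply/eqP => w0; have := prim_expr_order prim.
by rewrite w0 expr0n => /esym/eqP; rewrite oner_eq0.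
Qed.

Let node0 j : node j != 0.
Proof. by rewrite mulf_neq0. Qed.

(** Unnormalised Fourier coefficient of [v] at the frequency [x]. *)
Definition vhat (x : K) : R := \sum_(i < n.+1) v i * f (x ^+ i).

(* The plane waves [i |-> node b ^+ i] diagonalise the free operator with
   Floquet multiplier [zeta ^+ n.+1], while the potential becomes a circulant. *)
Lemma fourier_fmx :
  (\matrix_(a < n.+1, i < n.+1) f ((node a)^-1 ^+ i))
    *m fmx (fun i => v i + f c) (f (zeta ^+ n.+1)) (f (zeta ^- n.+1))
    *m (\matrix_(i < n.+1, b < n.+1) f (node b ^+ i))
  = \matrix_(a, b) (vhat (omega ^+ b / omega ^+ a)
      + (if a == b then f (n.+1%:R * (c + node b + (node b)^-1)) else 0)).
Proof.
rewrite -mulmxA; apply/matrixP => a b; rewrite !mxE.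
have nodeq : node b ^+ n.+1 = zeta ^+ n.+1.
  by rewrite exprMn exprAC (prim_expr_order prim) expr1n mulr1.
(* Column [b] is an eigenvector of the free part with eigenvalue [node b + (node b)^-1]; the
   boundary rows use [nodeq]. *)
have MS i : (fmx (fun i => v i + f c) (f (zeta ^+ n.+1)) (f (zeta ^- n.+1))
    *m (\matrix_(i < n.+1, b < n.+1) f (node b ^+ i))) i b
    = (v i + f (c + node b + (node b)^-1)) * f (node b ^+ i).
  rewrite mxE; under eq_bigr => j _ do rewrite [X in _ * X]mxE.
  rewrite (fmx_mulr _ _ _ (fun j => f (node b ^+ j))) !mulrDl !rmorphD /= !mulrDl -!addrA.
  congr (_ + (_ + (_ + _))).
    case: ifP => i_n; first by rewrite -rmorphM -exprS.
    have -> : (i : nat) = n by have := ltn_ord i; lia.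
    by rewrite expr0 rmorph1 mulr1 -nodeq -rmorphM -exprS.
  case: ifP => i0.
    by rewrite -rmorphM -{2}(prednK i0) exprS mulKf.
  have -> : (i : nat) = 0%N by lia.
  by rewrite expr0 rmorph1 mulr1 -nodeq -rmorphM exprSr invfM mulrAC mulVf ?mul1r ?expf_neq0.
under eq_bigr => i _ do rewrite [X in X * _]mxE MS mulrDl mulrDr.
rewrite big_split /=.
have xE i : (node a)^-1 ^+ i * node b ^+ i = (omega ^+ b / omega ^+ a) ^+ i.
  by rewrite -exprMn /node invfM mulrACA mulVf // mul1r mulrC.
congr (_ + _).
  by apply: eq_bigr => i _; rewrite mulrCA -rmorphM xE.
under eq_bigr => i _ do rewrite mulrCA -rmorphM xE.
rewrite -mulr_sumr -rmorph_sum -rmorphM.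
case: eqP => [->|/eqP ab].
  rewrite divff //; under eq_bigr => i _ do rewrite expr1n.
  by rewrite sumr_const card_ord mulrC.
rewrite sum_unity_root ?mulr0 ?rmorph0 //.
  by rewrite expr_div_n ![_ ^+ _ ^+ n.+1]exprAC (prim_expr_order prim) !expr1n divr1.
apply: contra ab => /eqP /divr1_eq /eqP; rewrite (eq_prim_root_expr prim).
by rewrite !modn_small // eq_sym.
Qed.

End Fourier.

(** * Second-order expansion of a determinant with two null diagonal constants *)

Lemma ord_ge1_prod (K : fieldType) m (T : Type) (s : seq T) (P : pred T)
    (G : T -> {mpoly K[m]}) (c : T -> K) :
  (forall t, P t -> ord_ge 1 (G t - (c t)%:MP)) ->
  ord_ge 1 (\prod_(t <- s | P t) G t - (\prod_(t <- s | P t) c t)%:MP).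
Proof.
move=> Gc; apply: (big_ind2 (fun x y => ord_ge 1 (x - y%:MP))) => //.
  by rewrite subrr; apply: ord_ge0.
move=> x1 y1 x2 y2 h1 h2; rewrite mpolyCM.
have -> : x1 * x2 - y1%:MP * y2%:MP = (x1 - y1%:MP) * x2 + (x2 - y2%:MP) * y1%:MP.
  by ring.
by apply: ord_geD; apply: (@ord_geM _ _ 1 0).
Qed.

(** The transposition of [a] and [b] yields the quadratic term. A permutation fixing [a] contributes
    zero, and any other moves a third index, so that three factors have order at least one. *)
Lemma det_order_two (K : fieldType) m N (L : 'M[{mpoly K[m]}]_N) (c : 'I_N -> K)
    (a b : 'I_N) :
    a != b -> (forall i j, ord_ge 1 (L i j)) -> L a a = 0 -> c a = 0 -> c b = 0 ->
  ord_ge 3 (\det (\matrix_(i, j) (L i j + (if i == j then (c i)%:MP else 0)))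
    + (\prod_(i | (i != a) && (i != b)) c i) *: (L a b * L b a)).
Proof.
move=> ab L1 Laa ca cb; set M := \matrix_(i, j) _.
have Moff i j : i != j -> M i j = L i j by move=> /negbTE ij; rewrite mxE ij addr0.
have Maa : M a a = 0 by rewrite mxE eqxx Laa ca mpolyC0 addr0.
have Ma j : ord_ge 1 (M a j).
  have [<-|aj] := eqVneq a j; first by rewrite Maa; apply: ord_ge0.
  by rewrite Moff.
have Mb j : ord_ge 1 (M b j).
  have [<-|aj] := eqVneq b j; last by rewrite Moff.
  by rewrite mxE eqxx cb mpolyC0 addr0.
rewrite /determinant (bigD1 (tperm a b)) //= addrAC; apply: ord_geD; last first.
  apply: ord_ge_sum => s s_ab.
  rewrite -[(-1) ^+ s]/((-1) ^+ (nat_of_bool s)) -signr_odd.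
  have sgZ (x : {mpoly K[m]}) k : ord_ge 3 x -> ord_ge 3 ((-1) ^+ k * x).
    by apply: (@ord_geM _ _ 0 3).
  apply: sgZ; have [sa|sa] := eqVneq (s a) a.
    by rewrite (bigD1 a) //= sa Maa mul0r; apply: ord_ge0.
  (* A permutation moving [a] and fixing everything outside [a] and [b] is the excluded
     transposition. *)
  have [e /and3P [ea eb se]] : exists e, [&& e != a, e != b & s e != e].
    apply/existsP.
    apply: contraNT s_ab => /existsPn fix_s; apply/eqP/permP.
    have fixs e : e != a -> e != b -> s e = e.
      by move=> ea eb; have := fix_s e; rewrite ea eb negbK => /eqP.
    have inj : injective s by apply: perm_inj.
    have sab : s a = b.
      apply/eqP; apply/negPn/negP => sab; case/eqP: (sa).
      exact/inj/fixs.
    have sba : s b = a.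
      apply/eqP; apply: contraNT ab => sba; rewrite -(inj_eq inj) sab.
      rewrite eq_sym; apply/eqP/inj/fixs => //.
      by apply: contraNneq sa => sbb; rewrite -(inj_eq inj) sab sbb.
    by move=> e; case: tpermP => [->|->|/eqP ea /eqP eb] //; apply: fixs.
  rewrite (bigD1 a) //= (bigD1 b) 1?eq_sym //= (bigD1 e) ?ea //=.
  rewrite -[3%N]/(1 + (1 + (1 + 0)))%N; do 3!apply: ord_geM => //.
  by rewrite Moff // eq_sym.
rewrite (bigD1 a) //= (bigD1 b) 1?eq_sym //= tpermL tpermR (Moff _ _ ab) (Moff b a) 1?eq_sym //.
rewrite odd_tperm ab expr1 mulN1r.
under eq_bigr => i /andP [ia ib] do rewrite tpermD 1?eq_sym // mxE eqxx.
set P := \prod_(i | _) (_ + _); set Q := \prod_(i | _) _.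
(* Replacing the remaining diagonal product by its constant part costs one order, which together
   with the two entries of [L] makes three. *)
have PQ : ord_ge 1 (P - Q%:MP).
  by apply: ord_ge1_prod => i _; rewrite addrK.
have -> : - (L a b * (L b a * P)) + Q *: (L a b * L b a)
    = (- 1)%:MP * (L a b * (L b a * (P - Q%:MP))).
  by rewrite -mul_mpolyC mpolyCN mpolyC1; ring.
by rewrite mul_mpolyC; apply: ord_geZ; rewrite -[3%N]/(1 + (1 + 1))%N; do 2!(apply: ord_geM => //).
Qed.

(** * Leading forms *)

Section WeightedDegree.
Variables (K : fieldType) (m : nat).
Implicit Types p q : {poly {mpoly K[m]}}.

(* The indeterminate of the outer polynomial ring counts as a variable. *)
Definition wdeg_le (D : nat) p :=
  forall b (e : 'X_{1..m}), e \in msupp p`_b -> (mdeg e + b <= D)%N.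

Lemma wdeg_le0 D : wdeg_le D 0.
Proof. by move=> b e; rewrite coef0 msupp0. Qed.

Lemma wdeg_leC (f : {mpoly K[m]}) D :
  (forall e, e \in msupp f -> (mdeg e <= D)%N) -> wdeg_le D f%:P.
Proof.
move=> fD b e; rewrite coefC; case: eqP => [->|_]; last by rewrite msupp0.
by rewrite addn0; apply: fD.
Qed.

Lemma wdeg_le1 : wdeg_le 0 1.
Proof. by apply: wdeg_leC => e; rewrite msupp1 inE => /eqP ->; rewrite mdeg0. Qed.

Lemma wdeg_leX : wdeg_le 1 'X.
Proof.
move=> b e; rewrite coefX; case: eqP => [->|_]; last by rewrite msupp0.
by rewrite msupp1 inE => /eqP ->; rewrite mdeg0.
Qed.

Lemma wdeg_leD D p q : wdeg_le D p -> wdeg_le D q -> wdeg_le D (p + q).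
Proof.
move=> pD qD b e; rewrite coefD => /msuppD_le; rewrite mem_cat.
by case/orP => [/pD|/qD].
Qed.

Lemma wdeg_leN D p : wdeg_le D p -> wdeg_le D (- p).
Proof. by move=> pD b e; rewrite coefN (perm_mem (msuppN _)) => /pD. Qed.

Lemma wdeg_leM D1 D2 p q : wdeg_le D1 p -> wdeg_le D2 q -> wdeg_le (D1 + D2) (p * q).
Proof.
move=> pD qD b e; rewrite coefM => /msupp_sum_le /flattenP [_ /mapP [i _ ->]].
move=> /msuppM_le /allpairsP [[e1 e2] /= [/pD d1 /qD d2 ->]].
by rewrite mdegD; have := ltn_ord i; lia.
Qed.

Lemma wdeg_le_sum D (T : Type) (s : seq T) (P : pred T) (G : T -> {poly {mpoly K[m]}}) :
  (forall t, P t -> wdeg_le D (G t)) -> wdeg_le D (\sum_(t <- s | P t) G t).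
Proof. by move=> GP; apply: big_ind => //; [apply: wdeg_le0 | apply: wdeg_leD]. Qed.

Lemma wdeg_le_prod (T : Type) (s : seq T) (D : T -> nat) (G : T -> {poly {mpoly K[m]}}) :
  (forall t, wdeg_le (D t) (G t)) -> wdeg_le (\sum_(t <- s) D t) (\prod_(t <- s) G t).
Proof.
move=> GP; apply: (big_ind2 (fun (x : {poly _}) y => wdeg_le y x)) => //.
  exact: wdeg_le1.
by move=> *; apply: wdeg_leM.
Qed.

Lemma wdeg_leW D1 D2 p : (D1 <= D2)%N -> wdeg_le D1 p -> wdeg_le D2 p.
Proof. by move=> D12 pD b e /pD /leq_trans; apply. Qed.

(** Diagonal entries have weighted degree at most one and the others zero. A permutation other than
    the identity moves at least two indices, leaving at most [n.-1] diagonal factors. *)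
Lemma det_fmx_top n (v : 'I_n.+1 -> {mpoly K[m]}) : (2 <= n)%N ->
  (forall i e, e \in msupp (v i) -> (mdeg e <= 1)%N) ->
  wdeg_le n.-1 (\det (fmx (fun i => (v i)%:P + 'X) 1 1) - \prod_i ((v i)%:P + 'X)).
Proof.
move=> n2 v1; rewrite /determinant (bigD1 1%g) //= odd_perm1 expr0 mul1r.
set M := fmx _ _ _.
have Mii i : M i i = (v i)%:P + 'X.
  have := ltn_ord i => i_n; rewrite mxE eqxx -[RHS]addr0 -[in RHS](addr0 0) addrA.
  congr (_ + _ + _).
    by case: ifP => i1; case: ifP => // /eqP i2; lia.
  by case: ifP => i1; case: ifP => // /eqP i2; lia.
have Mij i j : wdeg_le (i == j) (M i j).
  have [<-|ij] := eqVneq i j.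
    rewrite Mii; apply: wdeg_leD; last exact: wdeg_leX.
    by apply: wdeg_leC => e /v1.
  rewrite mxE (negbTE ij) add0r.
  have w01 (c : bool) : wdeg_le 0 (if c then 1 else 0 : {poly {mpoly K[m]}}).
    by case: c; [apply: wdeg_le1 | apply: wdeg_le0].
  by apply: wdeg_leD; case: (X in if X then _ else _) => /=; apply: w01.
under eq_bigr => i _ do rewrite perm1 Mii.
rewrite addrAC subrr add0r; apply: wdeg_le_sum => s s1.
have sgZ (x : {poly {mpoly K[m]}}) (k : bool) : wdeg_le n.-1 x -> wdeg_le n.-1 ((-1) ^+ k * x).
  by move=> xD; rewrite mulr_sign; case: ifP => // _; apply: wdeg_leN.
apply: sgZ; apply: (@wdeg_leW (\sum_i (i == s i))%N); last first.
  exact: (@wdeg_le_prod _ _ (fun i => i == s i : nat) (fun i => M i (s i))).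
have [i si] : exists i, s i != i.
  apply/existsP; apply: contraNT s1 => /existsPn fix_s.
  by apply/eqP/permP => i; rewrite perm1; apply/eqP; have := fix_s i; rewrite negbK.
have ssi : s (s i) != s i by rewrite (inj_eq perm_inj).
rewrite (bigD1 i) //= (bigD1 (s i)) //= eq_sym (negbTE si) eq_sym (negbTE ssi) !add0n.
apply: (@leq_trans (\sum_(j < n.+1 | (j != i) && (j != s i)) 1)).
  by apply: leq_sum => j _; apply: leq_b1.
rewrite sum1_card; have : (#|[pred j : 'I_n.+1 | (j != i) && (j != s i)]| + 2 = n.+1)%N.
  rewrite -[RHS](card_ord n.+1) [RHS](cardD1 i) [X in _ = (_ + X)%N](cardD1 (s i)).
  rewrite [s i \in _]inE si /=.
  rewrite addn2 !add1n; congr _.+2.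
  by apply: eq_card => j; rewrite !inE andbT andbC.
by rewrite addn2 => -[e]; rewrite -[X in (_ <= X.-1)%N]e.
Qed.

End WeightedDegree.

(** * Complete and elementary symmetric polynomials *)

Section Symmetric.
Variable R : comNzRingType.
Implicit Types (s t : seq R).

(** The complete homogeneous symmetric polynomial [h_k]. Its recursion shortens either the list or
    the degree, hence the nested fixpoint. *)
Fixpoint compl_sym (k : nat) s {struct s} : R :=
  if s is a :: s' then
    (fix hk k := if k is k'.+1 then compl_sym k s' + a * hk k' else 1) k
  else (k == 0%N)%:R.

(* [elem_sym k] is [(-1) ^+ k] times the [k]-th elementary symmetric polynomial. *)
Fixpoint elem_sym (k : nat) s : R :=
  if s is a :: s' then
    if k is k'.+1 then elem_sym k s' - a * elem_sym k' s' else 1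
  else (k == 0%N)%:R.

Arguments compl_sym : simpl never.

Lemma compl_sym0 s : compl_sym 0 s = 1.
Proof. by case: s. Qed.

Lemma compl_symS k a s : compl_sym k.+1 (a :: s) = compl_sym k.+1 s + a * compl_sym k (a :: s).
Proof. by []. Qed.

Lemma elem_sym0 s : elem_sym 0 s = 1.
Proof. by case: s. Qed.

Lemma elem_sym_oversize k s : (size s < k)%N -> elem_sym k s = 0.
Proof.
elim: s k => [|a s IH] [|k] //= sk.
by rewrite !IH ?mulr0 ?subrr //; lia.
Qed.

Lemma coef_prod_sqr s k : (k <= size s)%N ->
  (\prod_(y <- s) ('X^2 - y%:P))`_((size s - k).*2) = elem_sym k s.
Proof.
have size_prod (l : seq R) : (size (\prod_(y <- l) ('X^2 - y%:P))%R <= (size l).*2.+1)%N.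
  elim: l => [|a l IH]; first by rewrite big_nil size_polyC oner_eq0.
  rewrite big_cons; apply: (leq_trans (size_polyMleq _ _)).
  rewrite size_XnsubC //=; lia.
elim: s k => [|a s IH] k; first by rewrite leqn0 => /eqP ->; rewrite big_nil coefC.
rewrite big_cons mulrBl coefB coefCM coefXnM /= => ks.
case: k ks => [|k] ks.
  rewrite subn0 (_ : (_ < 2)%N = false); last by lia.
  rewrite [X in a * X]nth_default ?mulr0 ?subr0; last first.
    by apply: leq_trans (size_prod s) _; lia.
  by rewrite (_ : (_ - 2)%N = (size s - 0).*2) ?IH ?elem_sym0 //; lia.
rewrite subSS IH //; case: ltnP => k_s.
  by rewrite [elem_sym k.+1 s]elem_sym_oversize //; lia.
by rewrite (_ : (_ - 2)%N = (size s - k.+1).*2) ?IH //; lia.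
Qed.

Lemma perm_elem_sym k s t : perm_eq s t -> elem_sym k s = elem_sym k t.
Proof.
move=> st; have [ks|ks] := leqP k (size s).
  by rewrite -coef_prod_sqr // (perm_big _ st) (perm_size st) coef_prod_sqr // -(perm_size st).
by rewrite !elem_sym_oversize // -(perm_size st).
Qed.

(** Generating functions: the series of [compl_sym] on [s] is the inverse of the product of the
    [1 - a T] over [s], so it cancels the factors of [s] in the product over [s ++ t]. *)
Lemma compl_elem_sym s t k :
  \sum_(j < k.+1) compl_sym (k - j) s * elem_sym j (s ++ t) = elem_sym k t.
Proof.
elim: s k => [|a s IH] k /=.
  rewrite big_ord_recr /= subnn compl_sym0 mul1r big1 ?add0r // => j _.
  by rewrite /compl_sym (_ : (_ == _) = false) ?mul0r //; have := ltn_ord j; lia.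
case: k => [|k]; first by rewrite big_ord1 /= elem_sym0 mulr1.
pose T i := \sum_(j < i.+1) compl_sym (i - j) (a :: s) * elem_sym j (s ++ t).
have TS : T k.+1 = elem_sym k.+1 t + a * T k.
  rewrite -IH /T big_ord_recr [in RHS]big_ord_recr /= subnn compl_sym0 addrAC.
  rewrite mulr_sumr -big_split !compl_sym0 /=; congr (_ + _); apply: eq_bigr => j _.
  by rewrite subSn; [rewrite compl_symS mulrDl mulrA | rewrite -ltnS].
have -> : elem_sym k.+1 t = T k.+1 - a * T k by rewrite TS addrK.
rewrite /T big_ord_recl [in RHS]big_ord_recl -addrA /= !elem_sym0; congr (_ + _).
rewrite mulr_sumr -sumrB; apply: eq_bigr => j _.
by rewrite /bump /= add1n subSS; ring.
Qed.

End Symmetric.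

(** * Odd potentials *)

Section OddPotential.
Variables (K : numClosedFieldType) (n m : nat).
Hypotheses (n3 : (3 <= n)%N) (nm : (n.+1)./2 = m.+1).
Local Notation R := {mpoly K[m.+1]}.
Local Notation pow i c := (U_(i) *+ c)%MM.

Definition site_var (j : nat) : R := 'X_(inord j).

(** The period is [n.+1], with [m.+1] free values on the first sites and their negatives on the
    mirror sites; the middle site of an odd period carries 0. *)
Definition odd_pot (i : 'I_n.+1) : R :=
  if (i <= m)%N then site_var i
  else if (n - i <= m)%N then - site_var (n - i) else 0.

Lemma odd_pot_rev i : odd_pot (rev_ord i) = - odd_pot i.
Proof.
rewrite /odd_pot /= subSS; have := ltn_ord i; rewrite ltnS => i_n.
rewrite (subKn i_n); case: ifP => i1; case: ifP => i2; rewrite ?opprK ?oppr0 //.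
by have := odd_double_half n.+1; lia.
Qed.

Lemma odd_pot_linear i e : e \in msupp (odd_pot i) -> mdeg e = 1%N.
Proof.
rewrite /odd_pot; case: ifP => _; last case: ifP => _.
- by rewrite msuppX inE => /eqP ->; rewrite mdeg1.
- by rewrite (perm_mem (msuppN _)) msuppX inE => /eqP ->; rewrite mdeg1.
- by rewrite msupp0.
Qed.

Definition var_sqrs : seq R := [seq site_var j ^+ 2 | j <- iota 0 m.+1].

Lemma prod_odd_pot :
  \prod_i ((odd_pot i)%:P + 'X)
    = 'X^(odd n.+1) * \prod_(y <- var_sqrs) ('X^2 - y%:P).
Proof.
have nE := odd_double_half n.+1; rewrite nm in nE; move: (odd n.+1) nE => o nE.
(* The factors are extended to all natural indices, to split the product into the first half, a
   possible middle factor ['X], and the mirrored half. *)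
pose g (j : nat) : {poly R} := (if (j <= m)%N then site_var j
  else if (n - j <= m)%N then - site_var (n - j) else 0)%:P + 'X.
rewrite (eq_bigr (fun i : 'I_n.+1 => g i)) // -(big_mkord xpredT g).
rewrite (@big_cat_nat _ _ _ m.+1) ?leq0n //=; last by lia.
rewrite [X in _ * X](@big_cat_nat _ _ _ (m.+1 + o)) ?leq_addr //=; last by lia.
have -> : \prod_(m.+1 <= i < m.+1 + o) g i = 'X^(o).
  case: o nE => nE; last by rewrite addn0 big_geq.
  rewrite addn1 big_nat1 /g ltnn (_ : (n - m.+1 <= m)%N = false); last by lia.
  by rewrite add0r.
have -> : \prod_(m.+1 + o <= i < n.+1) g i = \prod_(0 <= i < m.+1) g (n - i)%N.
  rewrite big_nat_rev -{1}[(m.+1 + o)%N]add0n big_addn.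
  have -> : (n.+1 - (m.+1 + o) = m.+1)%N by lia.
  by apply: eq_big_nat => i im; congr g; lia.
rewrite mulrCA -big_split /=; congr (_ * _).
rewrite big_map -[iota 0 m.+1]/(index_iota 0 m.+1); apply: eq_big_nat => i im.
rewrite /g ltnS in im *.
have im' : (i <= m)%N by lia.
have -> : (n - i <= m)%N = false by lia.
have -> : (n - (n - i) = i)%N by lia.
by rewrite im' polyCN rmorphXn /=; ring.
Qed.

(* Locked, lest unification try to evaluate the determinants. *)
Definition disc : {poly R} := locked
  (\det (fmx (fun i => (odd_pot i)%:P + 'X) 1 1)
   - \det (fmx (fun _ : 'I_n.+1 => 0%:P + 'X) 1 1)).

(** In [disc] the indeterminate stands for minus the spectral parameter. By [det_fmx_diff] its
    specialisations give the difference of determinants for all multipliers at once. *)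
Lemma disc_eval (T : comNzRingType) (f : {rmorphism {poly R} -> T}) d c z w :
  z * w = 1 -> (forall i, f ((odd_pot i)%:P + 'X) = d i) -> f (0%:P + 'X) = c ->
  f disc = \det (fmx d z w) - \det (fmx (fun _ : 'I_n.+1 => c) z w).
Proof.
move=> zw fd fc; rewrite (det_fmx_diff _ _ _ zw); last by apply: ltnW.
have E1 := det_map_fmx f (fun i => (odd_pot i)%:P + 'X) 1 1.
have E0 := det_map_fmx f (fun _ : 'I_n.+1 => 0%:P + 'X) 1 1.
transitivity (f (\det (fmx (fun i => (odd_pot i)%:P + 'X) 1 1))
    - f (\det (fmx (fun _ : 'I_n.+1 => 0%:P + 'X) 1 1))).
  by rewrite /disc -lock raddfB.
have F1 : fmx (f \o (fun i => (odd_pot i)%:P + 'X)) (f 1) (f 1) = fmx d 1 1.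
  by rewrite (rmorph1 f); apply: eq_fmx.
have F0 : fmx (f \o (fun _ : 'I_n.+1 => 0%:P + 'X)) (f 1) (f 1) = fmx (fun=> c) 1 1.
  by rewrite (rmorph1 f); apply: eq_fmx.
rewrite F1 in E1; rewrite F0 in E0.
exact: (f_equal2 (fun x y => x - y) E1 E0).
Qed.

Lemma disc_top :
  wdeg_le n.-1 (disc - ('X^(odd n.+1) * \prod_(y <- var_sqrs) ('X^2 - y%:P) - 'X^(n.+1))).
Proof.
have n2 : (2 <= n)%N by apply: ltnW.
have h1 := @det_fmx_top K m.+1 n odd_pot n2.
have h0 := @det_fmx_top K m.+1 n (fun=> 0) n2.
have alg (a b p x : {poly R}) : a - b - (p - x) = (a - p) - (b - x) by ring.
have -> : 'X^(n.+1) = \prod_(i < n.+1) (0%:P + 'X) :> {poly R}.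
  by rewrite polyC0 add0r prodr_const card_ord.
rewrite -prod_odd_pot /disc -lock alg.
apply: wdeg_leD; first by apply: h1 => i e /odd_pot_linear ->.
by apply/wdeg_leN/h0 => i e; rewrite msupp0.
Qed.

(** The bound [n.-1] on the weighted degree leaves total degree at most [k.*2 - 2] in the
    coefficient of exponent [n.+1 - k.*2]. *)
Lemma coef_disc k : (0 < k <= m.+1)%N ->
  forall e, e \in msupp (disc`_(n.+1 - k.*2) - elem_sym k var_sqrs) ->
  (mdeg e <= k.*2 - 2)%N.
Proof.
move=> k_m e; have nE := odd_double_half n.+1; rewrite nm in nE.
have coefBB (p a b : {poly R}) i : (p - (a - b))`_i = p`_i - (a`_i - b`_i).
  by rewrite !coefB.
have := @disc_top (n.+1 - k.*2)%N e.
rewrite coefBB [X in _ - (X - _)]coefXnM coefXn.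
have c1 : (n.+1 - k.*2 == n.+1)%N = false by lia.
rewrite c1 [X in _ - X]subr0.
rewrite (_ : (_ < _)%N = false); last by lia.
have sz : size var_sqrs = m.+1 by rewrite size_map size_iota.
rewrite (_ : (_ - odd _)%N = (size var_sqrs - k).*2); last by lia.
rewrite coef_prod_sqr ?sz; last by lia.
by move=> h /h; lia.
Qed.

(** Negating the indeterminate and reversing the sites negates the whole diagonal, because the
    potential is odd. [det_fmxN] extracts the sign, and the corners it leaves, with product 1, do
    not affect the difference. *)
Lemma disc_compN : disc \Po - 'X = (-1) ^+ n.+1 * disc.
Proof.
pose s : {poly R} := (-1) ^+ n.+1.
have ss : s * s = 1 by rewrite /s -exprMn mulrNN mulr1 expr1n.
have -> : disc \Po - 'X = \det (fmx (fun i => (odd_pot i)%:P - 'X) 1 1)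
           - \det (fmx (fun _ : 'I_n.+1 => - 'X) 1 1).
  apply: (disc_eval (f := comp_poly (- 'X)) (mulr1 1)) => [i|] /=.
    by rewrite comp_polyD comp_polyC comp_polyX.
  by rewrite comp_polyD comp_polyC comp_polyX polyC0 add0r.
have flip (d : 'I_n.+1 -> R) : (forall i, d (rev_ord i) = - d i) ->
    \det (fmx (fun i => (d i)%:P - 'X) 1 1)
    = s * \det (fmx (fun i => (d i)%:P + 'X) s s).
  move=> dN; have -> : fmx (fun i => (d i)%:P - 'X) 1 1
      = fmx (fun i => - ((d (rev_ord i))%:P + 'X)) 1 1.
    by apply: eq_fmx => i; rewrite dN polyCN opprD opprK.
  have s1 : (-1) ^+ n.+1 * 1 = s by rewrite mulr1.
  rewrite det_fmxN s1.
  exact: (f_equal (fun x => s * x) (det_fmx_rev (fun i => (d i)%:P + 'X) s s)).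
rewrite (flip _ odd_pot_rev).
have flip0 := flip (fun=> 0) (fun=> esym (oppr0 _)).
have F0 : fmx (fun _ : 'I_n.+1 => 0%:P - 'X) 1 1 = fmx (fun=> - 'X) 1 1 :> 'M[{poly R}]_n.+1.
  by apply: eq_fmx => i; rewrite polyC0 add0r.
rewrite F0 in flip0; rewrite flip0 -mulrBr /disc -lock -/s.
exact/(f_equal (fun x => s * x))/det_fmx_diff/ss/ltnW.
Qed.

Lemma coef_disc_parity b : odd b != odd n.+1 -> disc`_b = 0.
Proof.
move=> ob; have := congr1 (fun p : {poly R} => p`_b) disc_compN.
have -> : (disc \Po - 'X)`_b = (-1) ^+ b * disc`_b.
  rewrite comp_polyE coef_sum.
  rewrite (eq_bigr (fun i : 'I_(size disc) => (-1) ^+ i * disc`_i * (b == i)%:R)).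
    have [bs|bs] := ltnP b (size disc).
      rewrite (bigD1 (Ordinal bs)) //= eqxx mulr1 big1 ?addr0 // => i ib.
      by rewrite (_ : (b == i) = false) ?mulr0 // eq_sym; apply: negbTE.
    rewrite [disc`_b]nth_default // mulr0 big1 // => i _.
    by rewrite (_ : (b == i) = false) ?mulr0 //; have := ltn_ord i; lia.
  move=> i _; rewrite coefZ; have -> : (- 'X : {poly R}) = (-1)%:P * 'X.
    by rewrite polyCN mulN1r.
  by rewrite exprMn -polyC_exp coefCM coefXn mulrA [_ * (-1) ^+ i]mulrC.
have -> : ((-1) ^+ n.+1 * disc)`_b = (-1) ^+ n.+1 * disc`_b.
  rewrite -signr_odd -[in RHS]signr_odd.
  by case: (odd n.+1); rewrite ?expr1 ?expr0 ?mulN1r ?mul1r ?coefN.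
rewrite -signr_odd -[X in _ = X * _]signr_odd.
have two (x : R) : x = - x -> x = 0.
  move=> /eqP; rewrite -addr_eq0 -mulr2n => /eqP x2; apply/mpolyP => e.
  have := congr1 (mcoeff e) x2; rewrite mcoeffMn !mcoeff0 => /eqP.
  by rewrite mulrn_eq0 => /eqP.
case: (odd b) (odd n.+1) ob => [] [] //= _; rewrite ?expr1 ?expr0 ?mulN1r ?mul1r.
  by move=> /esym; apply: two.
exact: two.
Qed.

(** Parity fixes [b] modulo 2. Exponents from [n.+1] on vanish, since the diagonal product is monic
    of degree [n.+1] and its top term cancels against the free one. *)
Lemma coef_disc_supp b : disc`_b != 0 ->
  exists2 k, (0 < k <= m.+1)%N & b = (n.+1 - k.*2)%N.
Proof.
move=> db; have nE := odd_double_half n.+1; rewrite nm in nE.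
have par : odd b = odd n.+1 by apply/eqP; apply: contraNT db => /coef_disc_parity ->.
have b_n : (b < n.+1)%N.
  rewrite ltnNge; apply: contra db => n_b.
  set P := 'X^(odd n.+1) * \prod_(y <- var_sqrs) ('X^2 - y%:P) - 'X^(n.+1).
  have -> : disc = (disc - P) + P by rewrite subrK.
  rewrite coefD (_ : (disc - P)`_b = 0) ?add0r.
    rewrite /P -prod_odd_pot coefB coefXn.
    have -> : \prod_i ((odd_pot i)%:P + 'X)
        = \prod_(i <- enum 'I_n.+1) ('X - (- odd_pot i)%:P).
      by rewrite big_enum; apply: eq_bigr => i _; rewrite polyCN opprK addrC.
    have sz := size_prod_XsubC (enum 'I_n.+1) (fun i => - odd_pot i).
    have mon := monic_prod_XsubC (enum 'I_n.+1) predT (fun i => - odd_pot i).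
    rewrite size_enum_ord in sz.
    have [->|bn] := eqVneq b n.+1.
      by move/monicP: mon; rewrite /lead_coef sz /= => ->; rewrite subrr.
    rewrite [X in X - _]nth_default; first by rewrite mulr0n subr0.
    by rewrite sz; lia.
  apply/eqP; rewrite -msupp_eq0 -size_eq0 -leqn0 leqNgt -has_predT.
  by apply/negP => /hasP [e /disc_top]; lia.
exists ((n.+1 - b)./2); have := odd_double_half (n.+1 - b); lia.
Qed.

(** The classical triangular generators for symmetric polynomials: the top part is [- h_(i+1)] of
    the squares of the variables from index [i] on. The last summand has coefficient 1, so the
    change of generators is invertible. *)
Definition disc_gen (i : 'I_m.+1) : R :=
  \sum_(j < i.+1) compl_sym (i - j) (drop i var_sqrs) * disc`_(n.+1 - j.+1.*2).

Lemma drop_var_sqrs i : (i <= m)%N ->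
  drop i var_sqrs = site_var i ^+ 2 :: drop i.+1 var_sqrs.
Proof.
move=> im; rewrite (drop_nth 0) ?size_map ?size_iota //.
by rewrite (nth_map 0%N) ?size_iota // nth_iota.
Qed.

(** Earlier variables are larger in the degree-lexicographic order. The recursion of [compl_sym]
    splits off the terms free of the [i]-th variable, which are smaller, and leaves its square times
    the polynomial of lower degree. *)
Lemma compl_sym_lead k i : (i <= m)%N -> forall e,
  e \in msupp (compl_sym k (drop i var_sqrs) - 'X_[pow (inord i) k.*2]) ->
  (e < pow (inord i) k.*2)%O.
Proof.
elim: k i => [|k IHk] i im e.
  by rewrite compl_sym0 mulm0n mpolyX0 subrr msupp0.
have [t] := ubnP (m - i); elim: t i im e => // t IHt i im e it.
have mS c : (pow (inord i) c + pow (inord i) 2 = pow (inord i) c.+2 :> 'X_{1..m.+1})%MM.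
  by apply/mnmP => j; rewrite mnmDE !mulmnE -mulnDr addn2.
have A_lt e' : e' \in msupp (compl_sym k.+1 (drop i.+1 var_sqrs)) ->
    (e' < pow (inord i) k.+1.*2)%O.
  have [i_m|i_m] := ltnP i m; last first.
    by rewrite drop_oversize ?size_map ?size_iota // /compl_sym /= msupp0.
  have lt_i : (pow (inord i.+1) k.+1.*2 < pow (inord i) k.+1.*2 :> 'X_{1..m.+1})%O.
    apply/ltmcP; first by rewrite !mdegMn !mdeg1.
    exists (inord i) => [j|]; last first.
      rewrite !mulmnE !mnm1E eqxx -(inj_eq val_inj) /= !inordK; lia.
    rewrite inordK; last by lia.
    move=> ji; rewrite !mulmnE !mnm1E -!(inj_eq val_inj) /= !inordK; lia.
  rewrite -{1}(subrK 'X_[pow (inord i.+1) k.+1.*2] (compl_sym _ _)) => /msuppD_le.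
  rewrite mem_cat => /orP [/(IHt i.+1)|].
    by move=> h; apply: lt_trans lt_i; apply: h; lia.
  by rewrite msuppX inE => /eqP ->.
rewrite drop_var_sqrs // compl_symS -drop_var_sqrs //.
have -> : compl_sym k.+1 (drop i.+1 var_sqrs)
    + site_var i ^+ 2 * compl_sym k (drop i var_sqrs) - 'X_[pow (inord i) k.+1.*2]
  = compl_sym k.+1 (drop i.+1 var_sqrs)
    + (compl_sym k (drop i var_sqrs) - 'X_[pow (inord i) k.*2]) * 'X_[pow (inord i) 2].
  by rewrite mulrBl -mpolyXD mS doubleS -addrA; congr (_ + (_ - _)); rewrite mulrC mpolyXn.
move/msuppD_le; rewrite mem_cat => /orP [/A_lt //|].
rewrite (perm_mem (msuppMX _ _)) => /mapP [e' /(IHk _ im) lt_e' ->].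
by rewrite doubleS -(mS k.*2) addmC ltmc_add2l.
Qed.

Lemma disc_genE i : exists2 g : R,
  disc_gen i = g - 'X_[pow i i.+1.*2] & forall e, e \in msupp g -> (e < pow i i.+1.*2)%O.
Proof.
have im : (i <= m)%N by rewrite -ltnS.
pose l := drop i var_sqrs.
pose low j : R := disc`_(n.+1 - j.+1.*2) - elem_sym j.+1 var_sqrs.
have lead := @compl_sym_lead i.+1 i im; rewrite -/l inord_val in lead.
(* In [compl_elem_sym] the right-hand side is of degree [i.+1] in the [i] squares of [take i], hence
   zero; the term of index 0 isolates [compl_sym i.+1 l]. *)
have cE : \sum_(j < i.+1) compl_sym (i - j) l * elem_sym j.+1 var_sqrs
    = - compl_sym i.+1 l.
  have := compl_elem_sym l (take i var_sqrs) i.+1.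
  rewrite elem_sym_oversize ?size_take ?size_map ?size_iota ?ltnS ?im //.
  rewrite big_ord_recl subn0 elem_sym0 mulr1 => /eqP; rewrite addr_eq0 => /eqP e.
  apply/esym/eqP; rewrite eqr_oppLR; apply/eqP; rewrite e; congr (- _).
  apply: eq_bigr => j _; rewrite lift0 subSS; congr (_ * _).
  by apply: perm_elem_sym; rewrite -[X in perm_eq _ X](cat_take_drop i) perm_catC.
exists (\sum_(j < i.+1) compl_sym (i - j) l * low j
        - (compl_sym i.+1 l - 'X_[pow i i.+1.*2])).
  rewrite opprB addrA addrAC addrK -cE -big_split; apply: eq_bigr => j _ /=.
  by rewrite -mulrDr subrK.
move=> e /msuppB_le; rewrite mem_cat => /orP [|/lead //].
move=> /msupp_sum_le /flattenP [_ /mapP [j _ ->]] /msuppM_le.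
move=> /allpairsP [[e1 e2] /= [e1l e2l ->]].
(* The lower parts have total degree at most [(i - j).*2 + j.*2], strictly below [i.+1.*2]. *)
have d2 : (mdeg e2 <= j.+1.*2 - 2)%N.
  by apply: coef_disc e2l; have := ltn_ord j; have := ltn_ord i; lia.
have d1 : (mdeg e1 <= (i - j).*2)%N.
  have := @compl_sym_lead (i - j)%N i im e1; rewrite -/l inord_val => h.
  have : e1 \in msupp ((compl_sym (i - j) l - 'X_[pow i (i - j).*2])
      + 'X_[pow i (i - j).*2]) by rewrite subrK.
  move=> /msuppD_le; rewrite mem_cat => /orP [/h/ltW/lemc_mdeg|].
    by rewrite mdegMn mdeg1 mul1n.
  by rewrite msuppX inE => /eqP ->; rewrite mdegMn mdeg1 mul1n.
apply: lt_mdeg_ltmc; rewrite mdegD mdegMn mdeg1 mul1n.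
by have := ltn_ord j; lia.
Qed.

Lemma mlead_disc_gen i : mlead (disc_gen i) = pow i i.+1.*2.
Proof.
have [g -> g_lt] := disc_genE i; rewrite addrC mleadDl mleadN mleadXm //.
have [->|g0] := eqVneq g 0; last exact/g_lt/mlead_supp.
by rewrite mlead0; apply: lt_mdeg_ltmc; rewrite mdeg0 mdegMn mdeg1; lia.
Qed.

Definition disc_ideal : R -> Prop := in_ideal disc_gen.

Lemma disc_idealP : is_ideal disc_ideal.
Proof.
by split; [apply: in_ideal0 | apply: in_idealD | move=> f g; apply: in_idealM].
Qed.

(** Inverts the triangular change of generators by strong induction on the index. *)
Lemma coef_disc_ideal b : disc_ideal disc`_b.
Proof.
have [I0 ID IM] := disc_idealP.
have [->|/coef_disc_supp [k k_m ->]] := eqVneq disc`_b 0; first exact: I0.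
case: k k_m => // k /=; rewrite ltnS; have [t] := ubnP k.
elim: t k => // t IH k kt k_m.
have := in_ideal_gen disc_gen (inord k).
rewrite /disc_gen inordK ?ltnS // big_ord_recr /= subnn compl_sym0 mul1r.
set S := \sum_(j < k) _ => SF.
have SI : disc_ideal S.
  apply: ideal_sum => [|j _]; first exact: disc_idealP.
  by apply/IM/IH; have := ltn_ord j; lia.
rewrite -[X in disc_ideal X](addKr S) addrC; apply: ID => //.
exact: idealN disc_idealP SI.
Qed.

Lemma disc_eval_ideal (c : R) : disc_ideal disc.[c].
Proof.
rewrite horner_coef; apply: ideal_sum => [|b _]; first exact: disc_idealP.
by have [_ _ IM] := disc_idealP; rewrite mulrC; apply/IM/coef_disc_ideal.
Qed.

Lemma odd_pot_var (i : 'I_m.+1) : odd_pot (inord i) = 'X_i.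
Proof.
have nE := odd_double_half n.+1; rewrite nm in nE; have i_m := ltn_ord i.
rewrite /odd_pot /site_var inordK; last by lia.
by rewrite -ltnS i_m inord_val.
Qed.

(** * Fourier modes of the odd potential *)

Variable omega : K.
Hypothesis prim : n.+1.-primitive_root omega.

Definition pot_hat (x : K) : R := vhat (@mpolyC m.+1 K) odd_pot x.

Lemma pot_hat_inv x : x ^+ n.+1 = 1 -> pot_hat x^-1 = - x *: pot_hat x.
Proof.
move=> xn; have x0 : x != 0.
  by apply/eqP => x0; move/eqP: xn; rewrite x0 expr0n eq_sym oner_eq0.
rewrite /pot_hat /vhat (reindex_inj (@rev_ord_inj n.+1)) scaler_sumr.
apply: eq_bigr => i _; rewrite odd_pot_rev /= subSS exprVn.
have -> : x ^- (n - i) = x * x ^+ i.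
  apply: (mulfI (expf_neq0 (n - i) x0)); rewrite divff ?expf_neq0 // -exprS -exprD.
  by have -> : (n - i + i.+1 = n.+1)%N by have := ltn_ord i; lia.
by rewrite mpolyCM -mul_mpolyC mpolyCN; ring.
Qed.

Lemma pot_hat1 : pot_hat 1 = 0.
Proof.
have := pot_hat_inv (expr1n _ n.+1); rewrite invr1 scaleN1r => /eqP.
rewrite -addr_eq0 -mulr2n => /eqP h; apply/mpolyP => e.
have := congr1 (mcoeff e) h; rewrite mcoeffMn !mcoeff0 => /eqP.
by rewrite mulrn_eq0 => /eqP.
Qed.

Lemma pot_hat_ord x : ord_ge 1 (pot_hat x).
Proof.
apply: ord_ge_sum => i _; rewrite mulrC mul_mpolyC; apply: ord_geZ.
by move=> e /odd_pot_linear ->.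
Qed.

Lemma root_pow j : (omega ^+ j) ^+ n.+1 = 1.
Proof. by rewrite exprAC (prim_expr_order prim) expr1n. Qed.

Lemma root_neq0 j : omega ^+ j != 0.
Proof.
by apply/eqP => w0; have /eqP := root_pow j; rewrite w0 expr0n eq_sym oner_eq0.
Qed.

(** The zero mode vanishes and inverse frequencies give proportional modes, so [m.+1] modes span
    them all. *)
Lemma pot_hat_span t : exists bk : K * 'I_m.+1,
  pot_hat (omega ^+ t) = bk.1 *: pot_hat (omega ^+ bk.2.+1).
Proof.
rewrite -(prim_expr_mod prim); have : (t %% n.+1 < n.+1)%N by rewrite ltn_mod.
move: (t %% n.+1)%N => {}t t_n; have nE := odd_double_half n.+1; rewrite nm in nE.
have [->|t0] := eqVneq t 0%N.
  by exists (0, ord0); rewrite scale0r expr0 pot_hat1.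
have [tm|tm] := leqP t m.+1.
  by exists (1, inord t.-1); rewrite /= scale1r inordK prednK //; lia.
exists (- omega ^+ (n.+1 - t), inord (n.+1 - t).-1); rewrite /=.
rewrite inordK; last by lia.
rewrite prednK; last by lia.
rewrite -pot_hat_inv ?root_pow //; congr pot_hat.
apply: (mulIf (root_neq0 (n.+1 - t))).
rewrite -exprD subnKC; last by lia.
by rewrite (prim_expr_order prim) mulVf ?root_neq0.
Qed.

Lemma fourier_inversion (i : 'I_n.+1) :
  n.+1%:R *: odd_pot i = \sum_(t < n.+1) omega ^- (i * t) *: pot_hat (omega ^+ t).
Proof.
have w0 := root_neq0.
under eq_bigr => t _ do rewrite /pot_hat /vhat scaler_sumr.
rewrite exchange_big /= (bigD1 i) //= [X in _ + X]big1 ?addr0 => [|j ji].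
  rewrite (eq_bigr (fun=> odd_pot i)) => [|t _].
    by rewrite sumr_const card_ord -scaler_nat.
  by rewrite mulrC mul_mpolyC scalerA -exprM mulnC mulVf ?scale1r.
rewrite (eq_bigr (fun t : 'I_n.+1 => (omega ^+ j / omega ^+ i) ^+ t *: odd_pot j)).
  rewrite -scaler_suml sum_unity_root ?scale0r //.
    by rewrite expr_div_n !root_pow divr1.
  apply: contra ji => /eqP /divr1_eq /eqP; rewrite (eq_prim_root_expr prim).
  by rewrite !modn_small.
move=> t _; rewrite mulrC mul_mpolyC scalerA expr_div_n -!exprM mulrC.
by rewrite [(t * j)%N]mulnC.
Qed.

(* At [lambda = zeta + zeta^-1] with [zeta ^+ 2 = omega ^+ k.+1], the unperturbed
   matrix has exactly the two null plane waves [zeta] and [zeta^-1]. *)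
Lemma pot_hat_sqr (k : 'I_m.+1) :
  exists2 b : R, ord_ge 3 b & disc_ideal (pot_hat (omega ^+ k.+1) ^+ 2 - b).
Proof.
have nE := odd_double_half n.+1; rewrite nm in nE; have k_m := ltn_ord k.
have w0 := root_neq0.
pose zeta := sqrtC (omega ^+ k.+1).
have zz : zeta * zeta = omega ^+ k.+1 by rewrite -expr2 sqrtCK.
have z0 : zeta != 0 by rewrite sqrtC_eq0.
pose c := - (zeta + zeta^-1); pose node j := zeta * omega ^+ j.
pose mu (j : 'I_n.+1) := n.+1%:R * (c + node j + (node j)^-1).
(* [node a] is [zeta], and [node b] is [zeta] times the inverse of [omega ^+ k.+1], that is
   [zeta^-1]. *)
pose a : 'I_n.+1 := ord0; pose b : 'I_n.+1 := inord (n - k).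
have bE : b = (n - k)%N :> nat by rewrite inordK //; lia.
have ab : a != b by rewrite -(inj_eq val_inj) /= bE; lia.
have wb : omega ^+ b = (omega ^+ k.+1)^-1.
  apply: (mulIf (w0 k.+1)); rewrite mulVf // -exprD bE.
  have -> : (n - k + k.+1 = n.+1)%N by lia.
  by rewrite (prim_expr_order prim).
have mua : mu a = 0.
  by rewrite /mu /node expr0 mulr1 /c; ring.
have mub : mu b = 0.
  have nb : node b = zeta^-1 by rewrite /node wb -zz invfM mulVKf.
  by rewrite /mu nb invrK /c; ring.
have mu0 j : j != a -> j != b -> mu j != 0.
  move=> ja jb; rewrite mulf_neq0 ?pnatr_eq0 //.
  have nj : node j != 0 by rewrite mulf_neq0.
  (* The factorisation shows that only the nodes [zeta] and [zeta^-1] are null. *)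
  have -> : c + node j + (node j)^-1 = (node j - zeta) * (1 - (node j * zeta)^-1).
    by rewrite /c; field; rewrite nj z0.
  rewrite mulf_neq0 //.
    rewrite subr_eq0; apply: contra ja => /eqP.
    rewrite -[X in _ = X]mulr1 => /(mulfI z0) /eqP.
    rewrite -(prim_order_dvd prim) => /dvdn_leq; have := ltn_ord j.
    by case: (posnP j) => [j0|_ h1 /(_ isT)]; [rewrite -(inj_eq val_inj) /= j0 | lia].
  rewrite subr_eq0 eq_sym invr_eq1; apply: contra jb.
  rewrite /node mulrAC zz -exprD -(prim_order_dvd prim) => /dvdnP [d dE].
  have := ltn_ord j => j_n; rewrite -(inj_eq val_inj) /= bE.
  by case: d dE => [|[|d]] dE; lia.
pose P := \matrix_(i < n.+1, j < n.+1) ((node i)^-1 ^+ j)%:MP_[m.+1].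
pose S := \matrix_(i < n.+1, j < n.+1) (node j ^+ i)%:MP_[m.+1].
pose z := zeta ^+ n.+1.
have FV := @fourier_fmx _ _ (@mpolyC m.+1 K) n omega zeta c odd_pot prim z0.
have F0 := @fourier_fmx _ _ (@mpolyC m.+1 K) n omega zeta c (fun=> 0) prim z0.
rewrite -/node -/P -/S -/z in FV F0.
set MV := \matrix_(i, j) _ in FV; set M0 := \matrix_(i, j) _ in F0.
have detM0 : \det M0 = 0.
  rewrite (expand_det_row M0 a) big1 // => j _; rewrite mxE /vhat.
  rewrite big1 ?add0r => [|i _]; last by rewrite mul0r.
  by case: eqP => [<-|_]; rewrite ?mul0r // -/(mu a) mua rmorph0 mul0r.
pose A := fmx (fun i => odd_pot i + c%:MP) z%:MP (z^-1)%:MP.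
pose A0 := fmx (fun _ : 'I_n.+1 => 0 + c%:MP) z%:MP (z^-1)%:MP : 'M[R]_n.+1.
have dA : disc.[c%:MP] = \det A - \det A0.
  have zw : z%:MP_[m.+1] * (z^-1)%:MP = 1.
    by rewrite -mpolyCM divff ?expf_neq0 // mpolyC1.
  by apply: (disc_eval (f := horner_eval c%:MP) zw) => [i|];
    rewrite /= /horner_eval hornerD hornerC hornerX.
have detMV : disc_ideal (\det MV).
  have [_ _ IM] := disc_idealP.
  (* The free product of determinants vanishes, so [\det MV] is a multiple of [\det A - \det A0],
     the value of [disc] at [c]. *)
  have alg (p x x0 y : R) : p * x0 * y = 0 -> p * x * y = p * y * (x - x0).
    by move=> h; rewrite -[LHS]subr0 -h; ring.
  have e0 : \det P * \det A0 * \det S = 0 by rewrite -detM0 -F0 !det_mulmx.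
  have -> : \det MV = \det P * \det A * \det S by rewrite -FV !det_mulmx.
  by rewrite (alg _ _ _ _ e0) -dA; apply/IM/disc_eval_ideal.
pose L := \matrix_(i < n.+1, j < n.+1) pot_hat (omega ^+ j / omega ^+ i).
have L1 i j : ord_ge 1 (L i j) by rewrite mxE; apply: pot_hat_ord.
have Laa : L a a = 0 by rewrite mxE divff // pot_hat1.
have := det_order_two ab L1 Laa mua mub.
have -> : \matrix_(i, j) (L i j + (if i == j then (mu i)%:MP else 0)) = MV.
  by apply/matrixP => i j; rewrite !mxE; case: eqP => // ->.
have -> : L a b = - omega ^+ k.+1 *: pot_hat (omega ^+ k.+1).
  by rewrite mxE expr0 divr1 wb pot_hat_inv ?root_pow.
have -> : L b a = pot_hat (omega ^+ k.+1) by rewrite mxE expr0 wb invrK mul1r.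
set Q := \prod_(i | _) _; set s := pot_hat _; set D := \det MV in detMV *.
have Q0 : Q * omega ^+ k.+1 != 0.
  by rewrite mulf_neq0 //; apply/prodf_neq0 => i /andP [ia ib]; apply: mu0.
set T := _ + _ => T3.
(* [T] is [D - (Q * omega ^+ k.+1) *: s ^+ 2], so this choice leaves a scalar multiple of [D], which
   is in the ideal. *)
exists (- (Q * omega ^+ k.+1)^-1 *: T); first exact: ord_geZ.
have -> : s ^+ 2 - - (Q * omega ^+ k.+1)^-1 *: T = (Q * omega ^+ k.+1)^-1 *: D.
  apply: (scalerI Q0).
  rewrite scalerBr !scalerA divff // mulrN divff // scale1r scaleN1r opprK /T.
  by rewrite -scalerAl !scalerA mulrN scaleNr -expr2; ring.
exact: idealZ disc_idealP detMV.
Qed.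

Lemma disc_zero_exists : (0 < m)%N ->
  exists2 x : 'I_m.+1 -> K, (exists i, x i != 0) & forall c, disc.[c%:MP].@[x] = 0.
Proof.
move=> m0; have [I0 ID IM] := disc_idealP.
have d0 (i : 'I_m.+1) : (0 < i.+1.*2)%N by [].
(* A variable that is not nilpotent modulo the ideal gives a zero with nonzero coordinate; the rest
   refutes that all are nilpotent. *)
have [[i0 nil]|nil] := classic (exists i0 : 'I_m.+1, forall e, ~ disc_ideal ('X_i0 ^+ e)).
  have [x x0 xI] := ideal_zero disc_idealP
    (fun i => in_ideal_algebraic d0 mlead_disc_gen 'X_i) nil.
  by exists x => [|c]; [exists i0 | apply/xI/disc_eval_ideal].
have {}nil i : exists e, disc_ideal ('X_i ^+ e).
  apply: NNPP => nie; apply: nil; exists i => e Ie; apply: nie.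
  by exists e.
have [bk bkE] := functional_choice _ pot_hat_span.
have span i : 'X_i = \sum_(t < n.+1) (n.+1%:R^-1 * omega ^- (i * t) * (bk t).1)
    *: pot_hat (omega ^+ (bk t).2.+1).
  have nE := odd_double_half n.+1; rewrite nm in nE; have i_m := ltn_ord i.
  have n0 : n.+1%:R != 0 :> K by rewrite pnatr_eq0.
  rewrite -(odd_pot_var i); apply: (scalerI n0).
  rewrite fourier_inversion inordK; last by lia.
  rewrite scaler_sumr; apply: eq_bigr => t _.
  by rewrite bkE !scalerA !mulrA divff // mul1r.
have high := @ideal_high_order K m.+1 m.+1 disc_ideal (fun k => pot_hat (omega ^+ k.+1))
  n.+1 _ (fun t => (bk t).2) disc_idealP
  (fun k => @pot_hat_ord (omega ^+ k.+1)) span pot_hat_sqr nil.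
have : disc_ideal 'X_[U_(ord_max) *+ m.+2].
  by apply/high/ord_geX; rewrite mdegMn mdeg1 mul1n.
move=> /(mlead_in_ideal d0 mlead_disc_gen) [|i].
  by rewrite -msupp_eq0 msuppX.
(* Only the last generator could divide, which requires [m.+1.*2 <= m.+2], impossible for
   [m > 0]. *)
rewrite mleadXm mulmnE mnm1E; case: eqP => [<-|_] /=; lia.
Qed.

End OddPotential.

(** * Primitive roots of unity and the isospectral potential *)

(** In characteristic zero ['X^q - 1] is separable, so it has [q] distinct roots, one of which is
    primitive. *)
Lemma prim_root_exists (K : numClosedFieldType) q : (0 < q)%N ->
  exists omega : K, q.-primitive_root omega.
Proof.
move=> q0; have [r] := closed_field_poly_normal ('X^q - 1 : {poly K}).
rewrite lead_coefXnsubC // scale1r => rE.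
have r1 : all q.-unity_root r by apply/allP=> z; rewrite -root_prod_XsubC -rE.
have sz : (q < (size r).+1)%N by rewrite -(size_prod_XsubC r id) -rE size_XnsubC.
have [|z _] := hasP (has_prim_root q0 r1 _ sz); last by exists z.
by rewrite -separable_prod_XsubC -rE separable_Xn_sub_1 // pnatr_eq0 -lt0n.
Qed.

Lemma floquet_detE n (v : 'I_n.+1 -> C) z lam :
  floquet_det v z lam = \det (fmx (fun i => v i - lam) z z^-1).
Proof.
congr (\det _); apply/matrixP => i j; rewrite !mxE /=.
have alg (d b c l : C) : d + b + c - l = d - l + b + c by ring.
have -> : (if i == j then v i - lam else 0) = (if i == j then v i else 0) - lam *+ (i == j).
  by case: (i == j); rewrite ?mulr1n ?mulr0n ?subr0.
exact: alg.
Qed.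

Theorem theorem4p4 (q : nat) (hq : (4 <= q)%N) :
  exists v : 'I_q -> C,
    (exists i : 'I_q, v i != 0) /\ floquet_isospectral v (fun _ => 0).
Proof.
case: q hq => // n n3.
(* The bound [q >= 4] gives at least two free values, that is [m > 0]. *)
have [m nm m0] : exists2 m, (n.+1)./2 = m.+1 & (0 < m)%N.
  by exists (n.+1)./2.-1; have := odd_double_half n.+1; lia.
have [omega prim] := prim_root_exists C (ltn0Sn n).
have [x [i0 xi0] x_disc] := disc_zero_exists n3 nm prim m0.
exists (fun i => (odd_pot C m i).@[x]); split.
  by exists (inord i0); rewrite (odd_pot_var C n3 nm) mevalXU.
move=> z lam z0; rewrite !floquet_detE; apply/eqP; rewrite -subr_eq0; apply/eqP.
(* The indeterminate of [disc] is sent to [- lam], then the free values to the zero [x]. *)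
pose f : {rmorphism {poly {mpoly C[m.+1]}} -> C} :=
  meval x \o horner_eval (- lam)%:MP.
have fD p : f (p%:P + 'X) = p.@[x] - lam.
  by rewrite /f /= /horner_eval hornerD hornerC hornerX mevalD mevalC.
have fE : f (disc C n m) = 0 by rewrite /f /= /horner_eval x_disc.
have := disc_eval n3 (divff z0) (fun i => fD _) (fD 0).
by rewrite fE meval0 => <-.
Qed.
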